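(* Let $\mathcal{F}$ be a nonempty finite set of finite fields each of size at most $q$, let $k\in\mathbb{N}$, and let $t=|\mathcal{F}|^{k+1}\,\mathrm{tower}(q,q,k,6)$. Then no excluded minor for the class of $\mathcal{F}$-representable matroids admits a sequence of $t$ nested $k$-separations.
   Context: A matroid is $\mathcal{F}$-representable if it is $\mathbb{F}$-representable for some $\mathbb{F}\in\mathcal{F}$. An excluded minor for a minor-closed class of matroids is a matroid not in the class all of whose proper minors are in the class. For a (finite) matroid $M$ and $X\subseteq E(M)$, let $\lambda_M(X)=r_M(X)+r_M(E(M)-X)-r_M(E(M))$. A $k$-separation of $M$ is a partition $(A,B)$ of $E(M)$ such that $|A|,|B|\ge k$ and $\lambda_M(A)<k$. A sequence $(A_1,B_1),\ldots,(A_t,B_t)$ of $k$-separations is nested if $A_1\subset A_2\subset\cdots\subset A_t$ (proper inclusions). $\mathrm{tower}(a_1,\ldots,a_n)=a_1^{a_2^{\cdot^{\cdot^{a_n}}}}$ (iterated exponentiation, evaluated from the top), so $\mathrm{tower}(q,q,k,6)=q^{q^{k^6}}$. *)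

(* Defs.v *)
From HB Require Import structures.
From mathcomp Require Import all_boot all_order all_algebra zify.

Set Implicit Arguments.
Unset Strict Implicit.
Unset Printing Implicit Defensive.

Import GRing.Theory.

(* A matroid whose ground set is a subset of T, presented by its rank
   function; the values of [rank] on sets not contained in [ground] are
   irrelevant, and nothing below depends on them. *)
Record matroid (T : finType) := Matroid {
  ground : {set T};
  rank : {set T} -> nat;
  rank_le_card : forall X : {set T}, X \subset ground -> rank X <= #|X|;
  rank_mono : forall X Y : {set T},
    X \subset Y -> Y \subset ground -> rank X <= rank Y;
  rank_submod : forall X Y : {set T}, X \subset ground -> Y \subset ground ->
    rank (X :|: Y) + rank (X :&: Y) <= rank X + rank Y
}.

Section Minors.
Variables (T : finType) (M : matroid T).

Section Deletion.
Variable D : {set T}.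

Lemma delete_le_card (X : {set T}) :
  X \subset ground M :\: D -> rank M X <= #|X|.
Proof. by rewrite subsetD => /andP[/rank_le_card]. Qed.

Lemma delete_mono (X Y : {set T}) :
  X \subset Y -> Y \subset ground M :\: D -> rank M X <= rank M Y.
Proof. by rewrite subsetD => sXY /andP[sY _]; apply: rank_mono. Qed.

Lemma delete_submod (X Y : {set T}) :
  X \subset ground M :\: D -> Y \subset ground M :\: D ->
  rank M (X :|: Y) + rank M (X :&: Y) <= rank M X + rank M Y.
Proof.
by rewrite !subsetD => /andP[sX _] /andP[sY _]; apply: rank_submod.
Qed.

Definition delete : matroid T :=
  Matroid delete_le_card delete_mono delete_submod.

End Deletion.

Section Contraction.
Variable C : {set T}.
Let C0 := ground M :&: C.

Definition contract_rank (X : {set T}) : nat :=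
  rank M (X :|: (ground M :&: C)) - rank M (ground M :&: C).

Let sub_ground (X : {set T}) :
  X \subset ground M :\: C -> X :|: C0 \subset ground M.
Proof. by rewrite subsetD subUset subsetIl => /andP[-> _]. Qed.

Let rank_C0 (X : {set T}) :
  X \subset ground M :\: C -> rank M C0 <= rank M (X :|: C0).
Proof. by move=> sX; apply: rank_mono; rewrite ?subsetUr ?sub_ground. Qed.

Lemma contract_le_card (X : {set T}) :
  X \subset ground M :\: C -> contract_rank X <= #|X|.
Proof.
rewrite subsetD => /andP[sX _]; rewrite /contract_rank -/C0.
have := rank_submod sX (subsetIl (ground M) C); rewrite -/C0.
by have := rank_le_card sX; lia.
Qed.

Lemma contract_mono (X Y : {set T}) :
  X \subset Y -> Y \subset ground M :\: C -> contract_rank X <= contract_rank Y.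
Proof.
move=> sXY sY; apply: leq_sub2r; apply: rank_mono; first exact: setSU.
exact: sub_ground.
Qed.

Lemma contract_submod (X Y : {set T}) :
  X \subset ground M :\: C -> Y \subset ground M :\: C ->
  contract_rank (X :|: Y) + contract_rank (X :&: Y)
    <= contract_rank X + contract_rank Y.
Proof.
move=> sX sY; rewrite /contract_rank -/C0.
have := rank_submod (sub_ground sX) (sub_ground sY).
rewrite -setUIl -setUUl.
have sI : X :&: Y \subset ground M :\: C by rewrite subIset ?sX.
have sU : X :|: Y \subset ground M :\: C by rewrite subUset sX.
by move: (rank_C0 sX) (rank_C0 sY) (rank_C0 sI) (rank_C0 sU); lia.
Qed.

Definition contract : matroid T :=
  Matroid contract_le_card contract_mono contract_submod.

End Contraction.

(* No truncation occurs in the subtraction, by submodularity. *)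
Definition connectivity (X : {set T}) : nat :=
  rank M X + rank M (ground M :\: X) - rank M (ground M).

(* Unlike [finset.partition], the parts may be empty (which matters only for
   k = 0). *)
Definition separation (k : nat) (AB : {set T} * {set T}) : bool :=
  [&& AB.1 :|: AB.2 == ground M, [disjoint AB.1 & AB.2],
      k <= #|AB.1|, k <= #|AB.2| & connectivity AB.1 < k].

Definition nested_separations (k : nat) (s : seq ({set T} * {set T})) : bool :=
  all (separation k) s &&
  sorted (fun AB AB' : {set T} * {set T} => AB.1 \proper AB'.1) s.

End Minors.

(* M is the matroid of a family of vectors over F, i.e. of the columns of a
   matrix over F indexed by the ground set. *)
Definition representable (F : fieldType) (T : finType) (M : matroid T) : Prop :=
  exists (n : nat) (v : T -> 'cV[F]_n),
    forall X : {set T}, X \subset ground M ->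
      rank M X = (\dim <<[seq v x | x in X]>>)%VS.

Definition family_representable (I : Type) (F : I -> finFieldType)
    (T : finType) (M : matroid T) : Prop :=
  exists i : I, representable (F i) M.

(* The minors of M are the matroids M / C \ D for disjoint C, D contained in
   the ground set; such a minor is proper when C and D are not both empty. *)
Definition excluded_minor (T : finType) (P : matroid T -> Prop)
    (M : matroid T) : Prop :=
  ~ P M /\
  forall C D : {set T}, C \subset ground M -> D \subset ground M ->
    [disjoint C & D] -> C :|: D != set0 -> P (delete (contract M C) D).

(* tower [:: a1; ...; an] = a1 ^ (a2 ^ (... ^ an)) *)
Definition tower (s : seq nat) : nat := foldr expn 1 s.

(* Main.v *)
Require Import Defs.
From HB Require Import structures.
From mathcomp Require Import all_boot all_order all_algebra zify.

(** Why the theorem holds.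

    Suppose that the excluded minor [M] has a very long nested sequence of
    [k]-separations.  Considering the orders [k - 1], ..., [0] in turn, either a
    block of the sequence is linked, meaning that no separation of smaller order
    lies between its first and last set, or many nested separations of
    smaller order can be found, one per block
    ([nested_order_bound]).  So there is a long chain of cuts of one order [m]
    whose two ends [P] and [~: S] are linked.  By Tutte's linking theorem
    ([linking]), there is a set [C] between the ends such that contracting [C]
    and deleting the rest keeps the connectivity at [m].

    Pick an element [e s] in every gap of the chain and treat it as [C]
    prescribes: contract it if it is in [C], and delete it otherwise.  The
    resulting minor is representable, and after restricting to part of the chain
    all these minors are representable over one field of size at most [q].
    In a representation, the interface at a cut is a space of dimension [m], and
    [C] identifies the interfaces of all cuts with a common space.  Hence a set on
    the left of a cut has a state, one of at most [q ^ (m * m)] subspaces, which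
    determines its behaviour towards the right ([state_congr]).  Counting states
    and relations between states ([splice_exists]) gives two minors, with indices
    [i < j], whose representations are compatible: gluing the one with index [j]
    on the left of a cut to the one with index [i] on the right ([glue]) gives a
    represented matroid [N] that has the ranks of [M] on all sets that follow [C]
    between some cut further left and the cut of gluing.

    It remains to see that [N] and [M] have the same rank on an arbitrary set [Q].
    Counting alone cannot show this, since a set that deviates from [C] at every
    element [e s] is visible in none of the minors used so far.  Therefore one
    uses another minor, at an element [x] of the end [P], treated as [Q]
    prescribes: contracted if [x] is in [Q] and deleted otherwise.  If this keeps
    the ends linked, then that minor too is governed by finitely many states, and
    if the splice respects them, then [Q] can be changed on the left of the cut
    to follow [C] near the cut, without affecting the comparison of [M] with [N].
    Among [2 * m + 1] elements of [P] one is suitable, unless [Q] has the same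
    rank, up to a known difference of at most [1], as a set for which one is
    ([end_correction]).  So [M] is represented by the vectors of [N], a
    contradiction ([assemble]). *)

Set Implicit Arguments.
Unset Strict Implicit.
Unset Printing Implicit Defensive.

Import GRing.Theory.

(** * Rank functions *)

Lemma subset_imply (T : finType) (X Y : {set T}) :
  X \subset Y -> forall z, (z \in X) ==> (z \in Y).
Proof. by move=> /subsetP h z; apply/implyP/h. Qed.

(** Sets are recorded by how they deviate from a default choice [C]. *)
Definition twist (T : finType) (C Z : {set T}) : {set T} :=
  [set x | (x \in C) (+) (x \in Z)].

(** Inclusions and identities between Boolean combinations of sets, decided by
    a truth table for one element. *)
Ltac set_cases z :=
  repeat match goal with
  | H : is_true (_ \subset _) |- _ => move/subset_imply/(_ z): H
  end;
  rewrite /twist ?inE;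
  repeat match goal with
  | |- context [z \in ?A] => case: (z \in A)
  | |- context [z == ?x] => case: (z == x)
  end; done.

Ltac set_dec :=
  let z := fresh "z" in
  match goal with
  | |- is_true (_ \subset _) => apply/subsetP => z; apply/implyP; set_cases z
  | |- _ = _ => apply/setP => z; apply/eqP; set_cases z
  end.

(** The rank axioms on all subsets of [T]; unlike for [matroid], there is no
    ground set to keep track of, and elements outside it become loops. *)
Record rank_fun (T : finType) (r : {set T} -> nat) : Prop := RankFun {
  rf_card : forall X : {set T}, r X <= #|X|;
  rf_mono : forall X Y : {set T}, X \subset Y -> r X <= r Y;
  rf_submod : forall X Y : {set T}, r (X :|: Y) + r (X :&: Y) <= r X + r Y
}.

Section RankFunctions.
Variables (T : finType) (r : {set T} -> nat).
Hypothesis hr : rank_fun r.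

Lemma rf_set0 : r set0 = 0.
Proof. by have := rf_card hr set0; rewrite cards0; lia. Qed.

(** Submodularity in the form used throughout: what [Z] adds to a set can only
    decrease when the set grows. *)
Lemma rf_marginal (X Y Z : {set T}) :
  X \subset Y -> r (Y :|: Z) + r X <= r (X :|: Z) + r Y.
Proof.
move=> sXY; have := rf_submod hr (X :|: Z) Y.
have -> : X :|: Z :|: Y = Y :|: Z by set_dec.
have : r X <= r ((X :|: Z) :&: Y) by apply: (rf_mono hr); set_dec.
by lia.
Qed.

Lemma rf_subadd (X Y : {set T}) : r (X :|: Y) <= r X + r Y.
Proof. by have := rf_submod hr X Y; lia. Qed.

Lemma rf_addU1 (x : T) (X : {set T}) : r (x |: X) <= (r X).+1.
Proof.
have := rf_subadd [set x] X; have := rf_card hr [set x]; rewrite cards1.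
by lia.
Qed.

Lemma rf_span (X Y : {set T}) :
  (forall y, y \in Y -> r (y |: X) = r X) -> r (X :|: Y) = r X.
Proof.
move: {2}#|Y| (erefl #|Y|) => n; elim: n Y => [|n IH] Y.
  by move/eqP; rewrite cards_eq0 => /eqP->; rewrite setU0.
move=> cY h; have /card_gt0P[y yY] : 0 < #|Y| by rewrite cY.
have IHy : r (X :|: (Y :\ y)) = r X.
  apply: IH => [|z]; first by move: cY; rewrite (cardsD1 y) yY => -[].
  by rewrite inE => /andP[_]; apply: h.
have := @rf_marginal X (X :|: (Y :\ y)) [set y] (subsetUl _ _).
rewrite IHy [X :|: [set y]]setUC (h y yY).
have -> : X :|: Y :\ y :|: [set y] = X :|: Y.
  by rewrite -setUA [_ :|: [set y]]setUC setD1K.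
have := rf_mono hr (subsetUl X Y); lia.
Qed.

(** Coloops can be removed one after the other, since each removal only makes
    the remaining ones contribute more. *)
Lemma rf_coloops (X D : {set T}) :
  D \subset X -> (forall x, x \in D -> r (X :\ x) < r X) ->
  r (X :\: D) + #|D| <= r X.
Proof.
move: {2}#|D| (erefl #|D|) => n; elim: n D => [|n IH] D.
  by move/eqP; rewrite cards_eq0 => /eqP->; rewrite setD0 cards0 addn0.
move=> cD sDX h; have /card_gt0P[y yD] : 0 < #|D| by rewrite cD.
have cDy : #|D :\ y| = n by move: cD; rewrite (cardsD1 y) yD => -[].
have := IH (D :\ y) cDy; rewrite cDy cD.
have sDy : D :\ y \subset X by set_dec.
have hDy x : x \in D :\ y -> r (X :\ x) < r X.
  by rewrite inE => /andP[_]; apply: h.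
move=> /(_ sDy hDy).
have yX : y \in X by apply: (subsetP sDX).
have sub : X :\: D \subset X :\ y.
  by apply/subsetP=> z; rewrite !inE => /andP[zD ->]; rewrite andbT; apply: contraNneq zD => ->.
have := @rf_marginal _ _ [set y] sub.
have -> : X :\ y :|: [set y] = X by rewrite setUC setD1K.
have -> : X :\: D :|: [set y] = X :\: (D :\ y).
  by apply/setP=> z; rewrite !inE; case: eqP => [->|]; rewrite ?yX ?orbT ?orbF.
by have := h y yD; lia.
Qed.

Lemma rf_redundant (X : {set T}) :
  r X < #|X| -> exists2 x, x \in X & r (X :\ x) = r X.
Proof.
move=> lt; suff /exists_inP[x xX /eqP e] : [exists x in X, r (X :\ x) == r X].
  by exists x.
apply: contraLR lt; rewrite negb_exists => /forallP h; rewrite -leqNgt.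
have := @rf_coloops X X (subxx _); rewrite setDv rf_set0 add0n; apply=> x xX.
have := h x; rewrite negb_and xX /= => ne.
by rewrite ltn_neqAle ne (rf_mono hr) ?subD1set.
Qed.

Lemma rf_basis (X : {set T}) :
  exists2 B : {set T}, B \subset X & r B = #|B| /\ r B = r X.
Proof.
move: {2}#|X| (leqnn #|X|) => n; elim: n X => [|n IH] X.
  rewrite leqn0 cards_eq0 => /eqP->; exists set0; rewrite ?sub0set //.
  by rewrite rf_set0 cards0.
move=> cX; have [h|h] := leqP #|X| (r X).
  by exists X => //; split=> //; apply/eqP; rewrite eqn_leq h (rf_card hr).
have [x xX rx] := rf_redundant h.
have cXx : #|X :\ x| <= n by move: cX; rewrite (cardsD1 x) xX.
have [B sB [cB eB]] := IH _ cXx.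
exists B; last by rewrite -rx.
exact: subset_trans sB (subD1set _ _).
Qed.

Lemma rf_same_span (X Y Z : {set T}) :
  X \subset Y -> r X = r Y -> r (Z :|: X) = r (Z :|: Y).
Proof.
move=> sXY e; have := rf_marginal Z sXY; rewrite !(setUC _ Z).
have : r (Z :|: X) <= r (Z :|: Y) by apply: (rf_mono hr); set_dec.
by lia.
Qed.

Lemma rf_indep_sub (X Y : {set T}) : r Y = #|Y| -> X \subset Y -> r X = #|X|.
Proof.
move=> eY sXY; apply/eqP; rewrite eqn_leq (rf_card hr) /=.
have := rf_subadd X (Y :\: X); have := rf_card hr (Y :\: X).
have -> : X :|: (Y :\: X) = Y by clear -sXY; set_dec.
rewrite eY; have := cardsID X Y.
by rewrite (setIidPr sXY); lia.
Qed.

Lemma rf_skew_sub (X Y Z : {set T}) :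
  r (Y :|: Z) = r Y + r Z -> X \subset Y -> r (X :|: Z) = r X + r Z.
Proof.
move=> e sXY; have := rf_marginal Z sXY; have := rf_subadd X Z.
by lia.
Qed.

End RankFunctions.

(** * Linking *)

Section Linking.
Variables (T : finType) (r : {set T} -> nat).
Hypothesis hr : rank_fun r.

(** The set [C] links the ends [P] and [~: S]: contracting [C] and deleting the
    rest of [S :\: P] leaves a matroid on the two ends in which they still have
    connectivity at least [m].  With the rank of the whole matroid on the left,
    the inequality also controls what [P :|: C] and [~: S :|: C] span. *)
Definition linked (R : {set T} -> nat) (m : nat) (P S C : {set T}) : Prop :=
  C \subset S :\: P /\
  R setT + R C + m <= R (P :|: C) + R (~: S :|: C).

Definition cut (R : {set T} -> nat) (m : nat) (P S A : {set T}) : Prop :=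
  [/\ P \subset A, A \subset S & R A + R (~: A) <= R setT + m].

(** Tutte's argument: an element in the middle can be contracted or deleted
    without dropping the connectivity between the ends.  If contracting [e]
    failed at [Z1] and deleting it failed at [Z2], uncrossing would give a
    separation of order less than [m] at [Z1 :&: Z2] or at [e |: (Z1 :|: Z2)].
    The sets [C] and [D] hold the elements already contracted and deleted. *)
Lemma linking_step (m : nat) (P S : {set T}) n :
  P \subset S ->
  forall C D : {set T}, C \subset S :\: P -> D \subset S :\: P ->
  #|(S :\: P) :\: (C :|: D)| = n ->
  (forall Z : {set T}, P \subset Z -> Z \subset S :\: (C :|: D) ->
     r setT + r C + m <= r (Z :|: C) + r (~: (Z :|: C :|: D) :|: C)) ->
  exists2 C' : {set T}, C' \subset S :\: P &
    r setT + r C' + m <= r (P :|: C') + r (~: S :|: C').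
Proof.
move=> sPS; elim: n => [|n IH] C D sC sD.
  move=> /eqP; rewrite cards_eq0 => /eqP e h; exists C => //.
  move: (h P (subxx _)).
  have e' : (S :\: P) \subset (C :|: D) by rewrite -setD_eq0 e.
  have -> : ~: (P :|: C :|: D) :|: C = ~: S :|: C.
    by clear h; set_dec.
  by apply; clear h; set_dec.
move=> cR h; have /card_gt0P[e eR] : 0 < #|(S :\: P) :\: (C :|: D)| by rewrite cR.
have cR' : #|(S :\: P) :\: (C :|: D) :\ e| = n.
  by move: cR; rewrite (cardsD1 e) eR => -[].
have eP : e \notin P by move: eR; rewrite !inE; case: (e \in P); rewrite ?andbF.
have eS : e \in S by move: eR; rewrite !inE => /and3P[].
have eC : e \notin C by move: eR; rewrite !inE negb_or => /andP[/andP[]].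
have eD : e \notin D by move: eR; rewrite !inE negb_or => /andP[/andP[]].
pose good (C D Z : {set T}) := [&& P \subset Z & Z \subset S :\: (C :|: D)] ==>
  (r setT + r C + m <= r (Z :|: C) + r (~: (Z :|: C :|: D) :|: C)).
have goodP C1 D1 : (forall Z, good C1 D1 Z) ->
    forall Z : {set T}, P \subset Z -> Z \subset S :\: (C1 :|: D1) ->
     r setT + r C1 + m <= r (Z :|: C1) + r (~: (Z :|: C1 :|: D1) :|: C1).
  by move=> hg Z h1 h2; have := hg Z; rewrite /good h1 h2.
have seSP : [set e] \subset S :\: P by rewrite sub1set inE eP.
have [/forallP hc|] := boolP [forall Z, good (e |: C) D Z].
  apply: (IH (e |: C) D) => //; last exact: goodP hc.
    by rewrite subUset seSP.
  rewrite -cR'; congr #|pred_of_set _|; clear; set_dec.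
have [/forallP hd _|] := boolP [forall Z, good C (e |: D) Z].
  apply: (IH C (e |: D)) => //; last exact: goodP hd.
    by rewrite subUset seSP.
  rewrite -cR'; congr #|pred_of_set _|; clear; set_dec.
rewrite !negb_forall => /existsP[Z2 b2] /existsP[Z1 b1].
move: b2 b1; rewrite !negb_imply -!ltnNge.
move=> /andP[/andP[p2 s2] lt2] /andP[/andP[p1 s1] lt1].
have e1 : e \notin Z1.
  by apply: contraTN s1 => ez; apply/subsetPn; exists e; rewrite // !inE eqxx.
have e2 : e \notin Z2.
  by apply: contraTN s2 => ez; apply/subsetPn; exists e; rewrite // !inE eqxx orbT.
have hU := h (e |: (Z1 :|: Z2)).
have hI := h (Z1 :&: Z2).
have : P \subset e |: (Z1 :|: Z2) by clear -p1; set_dec.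
move=> /hU{}hU; have : e |: (Z1 :|: Z2) \subset S :\: (C :|: D).
  rewrite subUset; apply/andP; split; last by clear -s1 s2; set_dec.
  by rewrite sub1set !inE eS negb_or eC eD.
move=> /hU{}hU.
have : P \subset Z1 :&: Z2 by clear -p1 p2; set_dec.
move=> /hI{}hI; have : Z1 :&: Z2 \subset S :\: (C :|: D) by clear -s1 s2; set_dec.
move=> /hI{}hI.
have sub1 := rf_submod hr (Z1 :|: (e |: C)) (Z2 :|: C).
have sub2 := rf_submod hr (~: (Z1 :|: (e |: C) :|: D) :|: (e |: C))
                          (~: (Z2 :|: C :|: (e |: D)) :|: C).
have m1 : r (e |: (Z1 :|: Z2) :|: C) <= r (Z1 :|: (e |: C) :|: (Z2 :|: C)).
  by apply: (rf_mono hr); clear; set_dec.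
have m2 : r (Z1 :&: Z2 :|: C) <= r ((Z1 :|: (e |: C)) :&: (Z2 :|: C)).
  by apply: (rf_mono hr); clear; set_dec.
have m3 : r (~: (Z1 :&: Z2 :|: C :|: D) :|: C) <=
   r ((~: (Z1 :|: (e |: C) :|: D) :|: (e |: C)) :|: (~: (Z2 :|: C :|: (e |: D)) :|: C)).
  by apply: (rf_mono hr); clear; set_dec.
have m4 : r (~: (e |: (Z1 :|: Z2) :|: C :|: D) :|: C) <=
   r ((~: (Z1 :|: (e |: C) :|: D) :|: (e |: C)) :&: (~: (Z2 :|: C :|: (e |: D)) :|: C)).
  by apply: (rf_mono hr); clear; set_dec.
have := rf_addU1 hr e C.
by clear -hU hI lt1 lt2 sub1 sub2 m1 m2 m3 m4; lia.
Qed.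

(** The linking theorem.  Only the span of [C] matters, so [C] can be taken to be
    independent. *)
Lemma linking (m : nat) (P S : {set T}) :
  P \subset S ->
  (forall Z : {set T}, P \subset Z -> Z \subset S -> r setT + m <= r Z + r (~: Z)) ->
  exists2 C : {set T}, linked r m P S C & r C = #|C|.
Proof.
move=> sPS h.
have [|C sC hC] :=
  @linking_step m P S _ sPS set0 set0 (sub0set _) (sub0set _) (erefl _).
  move=> Z p s; rewrite !setU0 rf_set0 // addn0; apply: h => //.
  by move: s; rewrite setU0 setD0.
have [B sB [cB eB]] := rf_basis hr C.
exists B => //; split; first exact: subset_trans sB sC.
by rewrite !(rf_same_span hr _ sB eB) eB.
Qed.

(** A linked pair of ends carries the full order of every cut, so all the
    submodular inequalities between the cut, the ends and [C] are tight. *)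
Lemma linked_cutP (m : nat) (P S C A : {set T}) :
  linked r m P S C -> cut r m P S A ->
  [/\ r (P :|: C :&: A) = r A, r (~: S :|: C :\: A) = r (~: A),
      r (A :|: C :\: A) = r A + r (C :\: A) &
      r (~: A :|: C :&: A) = r (~: A) + r (C :&: A)] /\
  [/\ r C = r (C :&: A) + r (C :\: A), r A + r (~: A) = r setT + m,
      r (P :|: C) = r A + r (C :\: A) & r (~: S :|: C) = r (~: A) + r (C :&: A)].
Proof.
move=> [sC hC] [sPA sAS hA].
have m1 := @rf_marginal _ _ hr (C :&: A) (P :|: C :&: A) (C :\: A) (subsetUr _ _).
have m2 := @rf_marginal _ _ hr (C :\: A) (~: S :|: C :\: A) (C :&: A) (subsetUr _ _).
have e1 : P :|: C :&: A :|: C :\: A = P :|: C by rewrite -setUA setID.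
have e2 : ~: S :|: C :\: A :|: C :&: A = ~: S :|: C.
  by rewrite -setUA [C :\: A :|: _]setUC setID.
rewrite setID e1 in m1; rewrite [C :\: A :|: _]setUC setID e2 in m2.
have m3 : r (P :|: C :&: A) <= r A by apply: (rf_mono hr); clear hC hA; set_dec.
have m4 : r (~: S :|: C :\: A) <= r (~: A) by apply: (rf_mono hr); clear hC hA; set_dec.
have m5 : r C <= r (C :&: A) + r (C :\: A).
  by rewrite -{1}(setID C A); apply: rf_subadd.
have m6 := rf_subadd hr A (C :\: A).
have m7 := rf_subadd hr (~: A) (C :&: A).
have m8 : r (P :|: C) <= r (A :|: C :\: A) by apply: (rf_mono hr); clear hC hA; set_dec.
have m9 : r (~: S :|: C) <= r (~: A :|: C :&: A) by apply: (rf_mono hr); clear hC hA; set_dec.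
by split; split; lia.
Qed.

End Linking.

(** * States of a represented matroid at a cut *)

Section Spans.
Variables (F : fieldType) (T : finType).

Definition sp (V : vectType F) (v : T -> V) (X : {set T}) : {vspace V} :=
  <<[seq v x | x in X]>>%VS.

Definition vrank (V : vectType F) (v : T -> V) (X : {set T}) : nat :=
  \dim (sp v X).

Lemma sp_limg (V W : vectType F) (g : 'Hom(V, W)) (v : T -> V) (w : T -> W)
    (X : {set T}) :
  {in X, forall x, w x = g (v x)} -> sp w X = (g @: sp v X)%VS.
Proof.
move=> h; rewrite /sp limg_span /image_mem -map_comp; congr <<_>>%VS.
by apply/eq_in_map=> x; rewrite mem_enum => /h.
Qed.

Variables (V : vectType F) (v : T -> V).

Lemma memv_sp (x : T) (X : {set T}) : x \in X -> v x \in sp v X.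
Proof. by move=> xX; apply/memv_span/imageP; exists x. Qed.

Lemma sp_subP (X : {set T}) (U : {vspace V}) :
  reflect {in X, forall x, v x \in U} (sp v X <= U)%VS.
Proof.
apply: (iffP span_subvP) => [h x xX|h _ /imageP[x xX ->]]; last exact: h.
by apply: h; apply/imageP; exists x.
Qed.

Lemma spS (X Y : {set T}) : X \subset Y -> (sp v X <= sp v Y)%VS.
Proof. by move=> /subsetP s; apply/sp_subP=> x /s; apply: memv_sp. Qed.

Lemma spU (X Y : {set T}) : sp v (X :|: Y) = (sp v X + sp v Y)%VS.
Proof.
apply/eqP; rewrite eqEsubv subv_add !spS ?subsetUl ?subsetUr // !andbT.
apply/sp_subP=> x; rewrite inE => /orP[] xX.
  by apply: subvP (addvSl _ _) _ _; apply: memv_sp.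
by apply: subvP (addvSr _ _) _ _; apply: memv_sp.
Qed.

Lemma sp1 (x : T) : sp v [set x] = <[v x]>%VS.
Proof.
apply/eqP; rewrite eqEsubv; apply/andP; split.
  by apply/sp_subP=> y; rewrite inE => /eqP->; apply: memv_line.
by rewrite -memvE memv_sp ?inE.
Qed.

Lemma sp_same_dim (X Y : {set T}) :
  X \subset Y -> vrank v X = vrank v Y -> sp v X = sp v Y.
Proof. by move=> /spS s e; apply/eqP; rewrite eqEdim s; rewrite /vrank in e; rewrite e /=. Qed.

Lemma sp_skew (X Y : {set T}) :
  vrank v (X :|: Y) = vrank v X + vrank v Y -> (sp v X :&: sp v Y = 0)%VS.
Proof.
rewrite /vrank spU => e; apply/eqP; rewrite -dimv_eq0.
by have := dimv_sum_cap (sp v X) (sp v Y); lia.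
Qed.

Lemma vrankP : rank_fun (vrank v).
Proof.
split=> [X|X Y s|X Y].
- by rewrite (leq_trans (dim_span _)) // size_image.
- exact/dimvS/spS.
rewrite /vrank spU -(dimv_sum_cap (sp v X)) leq_add2l; apply: dimvS.
by rewrite subv_cap !spS ?subsetIl ?subsetIr.
Qed.

End Spans.

Section LinearMaps.
Variables (F : fieldType).

Lemma lfun_of_linear (V W : vectType F) (f : V -> W) :
  linear f -> exists g : 'Hom(V, W), g =1 f.
Proof.
move=> lf; pose L : {linear V -> W} := HB.pack f (GRing.isLinear.Build _ _ _ _ f lf).
by exists (linfun L) => x; rewrite lfunE.
Qed.

(** Compose the projection to [U] along [K] with coordinates in a basis of [U],
    padded with zeros up to length [m]. *)
Lemma frame_map (V : vectType F) (m : nat) (U K : {vspace V}) :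
  (U :&: K = 0)%VS -> \dim U <= m ->
  exists p : 'Hom(V, 'rV[F]_m), (K <= lker p)%VS /\ (U :&: lker p = 0)%VS.
Proof.
move=> UK leU.
pose c (x : V) : 'rV[F]_(\dim U) := (\row_i coord (vbasis U) i (daddv_pi U K x))%R.
have lc : linear c.
  by move=> a x y; apply/rowP=> i; rewrite !mxE !linearP.
pose p (x : V) : 'rV[F]_m := (c x *m pid_mx (\dim U))%R.
have lp : linear p by move=> a x y; rewrite /p lc mulmxDl scalemxAl.
have [L LE] := lfun_of_linear lp.
exists L; split.
  apply/subvP=> k kK; rewrite memv_ker LE /p.
  have : daddv_pi U K k = 0%R.
    have := daddv_pi_add UK (subvP (addvSr U K) _ kK).
    rewrite (daddv_pi_id _ kK) 1?capvC //.
    by move/(canRL (addrK _)); rewrite subrr.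
  move=> e; apply/eqP; suff -> : c k = 0%R by rewrite mul0mx.
  by apply/rowP=> i; rewrite !mxE e linear0.
apply/eqP; rewrite -subv0; apply/subvP=> x /memv_capP[xU].
rewrite memv_ker LE /p => /eqP e; rewrite memv0.
have free : row_free (pid_mx (\dim U) : 'M[F]_(\dim U, m)).
  by rewrite /row_free rank_pid_mx.
have c0 : c x = 0%R by apply: (row_free_inj free); rewrite e mul0mx.
rewrite (coord_vbasis xU) big1 // => i _.
have := congr1 (fun r : 'rV_ _ => r 0%R i) c0; rewrite !mxE daddv_pi_id // => ->.
by rewrite scale0r.
Qed.

Lemma limg_cap_inj (V W : vectType F) (p : 'Hom(V, W)) (D X Y : {vspace V}) :
  (D :&: lker p = 0)%VS -> (X <= D)%VS -> (Y <= D)%VS ->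
  (p @: (X :&: Y) = (p @: X) :&: (p @: Y))%VS.
Proof.
move=> inj sX sY; apply/eqP; rewrite eqEsubv limg_cap /=.
apply/subvP=> _ /memv_capP[/memv_imgP[x xX ->] /memv_imgP[y yY e]].
suff xy : x = y by apply: memv_img; apply/memv_capP; split; rewrite // xy.
apply/eqP; rewrite -subr_eq0 -memv0 -inj; apply/memv_capP; split.
  by apply: memvB; [apply: (subvP sX) | apply: (subvP sY)].
by rewrite memv_ker linearB /= e subrr.
Qed.

(** Modulo the kernel of [p], a vector of [K] can be moved from one side of the
    intersection to the other. *)
Lemma limg_shift (V W : vectType F) (p : 'Hom(V, W)) (K X Y : {vspace V}) :
  (K <= lker p)%VS -> (p @: ((X + K) :&: Y) = p @: (X :&: (Y + K)))%VS.
Proof.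
move=> sK; suff h (X1 Y1 : {vspace V}) :
    (p @: ((X1 + K) :&: Y1) <= p @: (X1 :&: (Y1 + K)))%VS.
  by apply/eqP; rewrite eqEsubv h capvC [(_ :&: Y)%VS]capvC h.
apply/subvP=> _ /memv_imgP[_ /memv_capP[/memv_addP[x xX [k kK ->]] xkY] ->].
have /eqP pk : p k == 0%R by rewrite -memv_ker (subvP sK).
rewrite linearD /= pk addr0; apply: memv_img; apply/memv_capP; split=> //.
by rewrite -[x](addrK k) memv_add // memvN.
Qed.

End LinearMaps.

Section States.
Variables (F : fieldType) (T : finType) (V : vectType F) (v : T -> V).
Variables (m : nat) (P S C : {set T}).
Hypothesis lk : linked (vrank v) m P S C.

(** Everything that one side of a cut can see of the other: whether [X] on the
    left and [Y] on the right interact depends only on how their spans meet this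
    space. *)
Definition interface (A : {set T}) : {vspace V} := (sp v A :&: sp v (~: A))%VS.

Lemma dim_interface (X Y : {set T}) :
  vrank v (X :|: Y) + \dim (sp v X :&: sp v Y) = vrank v X + vrank v Y.
Proof. by rewrite /vrank spU dimv_sum_cap. Qed.

Lemma cut_spans (A : {set T}) : cut (vrank v) m P S A ->
  [/\ sp v A = (sp v P + sp v (C :&: A))%VS,
      sp v (~: A) = (sp v (~: S) + sp v (C :\: A))%VS,
      (sp v A :&: sp v (C :\: A) = 0)%VS,
      (sp v (~: A) :&: sp v (C :&: A) = 0)%VS & \dim (interface A) = m].
Proof.
move=> cA; have [[e1 e2 e3 e4] [_ e5 _ _]] := linked_cutP (vrankP v) lk cA.
have [sC _] := lk; have [sP sA _] := cA.
split; last 1 first.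
- have := dim_interface A (~: A); rewrite setUCr /interface; lia.
- by rewrite -spU; apply/esym/sp_same_dim => //; clear -sC sP; set_dec.
- by rewrite -spU; apply/esym/sp_same_dim => //; clear -sC sA; set_dec.
- exact: sp_skew.
- exact: sp_skew.
Qed.

Lemma interface_skew (A : {set T}) : cut (vrank v) m P S A ->
  (interface A :&: sp v C = 0)%VS.
Proof.
move=> /cut_spans[_ _ sk1 sk2 _].
apply/eqP; rewrite -subv0 -(setID C A) spU.
apply/subvP=> _ /memv_capP[/[swap] /memv_addP[c cA [d dA ->]] /memv_capP[h1 h2]].
have d0 : d \in (sp v A :&: sp v (C :\: A))%VS.
  rewrite memv_cap dA andbT -(addrK c d) [(d + c)%R]addrC memvB //.
  by apply: subvP cA; apply: spS; apply: subsetIr.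
move: d0; rewrite sk1 memv0 => /eqP d0; move: h2; rewrite d0 addr0 => h2.
by rewrite -sk2; apply/memv_capP.
Qed.

(** Contracting [C] identifies the interfaces of all cuts with one and the same
    coordinate space, so that the states defined below can be compared across
    cuts and across representations. *)
Definition frame (p : 'Hom(V, 'rV[F]_m)) : Prop :=
  (sp v C <= lker p)%VS /\
  forall A : {set T}, cut (vrank v) m P S A -> (interface A :&: lker p = 0)%VS.

(** A map that works for the interface at [P] works at every cut, because modulo
    [sp v C] the interface at [A] is contained in the one at [P]. *)
Lemma frame_exists : cut (vrank v) m P S P -> exists p, frame p.
Proof.
move=> cP; have [_ _ _ _ dP] := cut_spans cP.
have [|p [kerC kerP]] := frame_map (interface_skew cP) (m := m).
  by rewrite dP.
exists p; split=> // A cA; have [sC _] := lk; have [sPA sAS _] := cA.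
have [eA _ _ _ _] := cut_spans cA.
apply/eqP; rewrite -subv0; apply/subvP=> a /memv_capP[aI ka].
have /memv_capP[] := aI; rewrite eA => /memv_addP[x xP [c cC e]] aA.
have pc : p c = 0%R.
  apply/eqP; rewrite -memv_ker; apply: (subvP kerC).
  by apply: subvP cC; apply: spS; apply: subsetIl.
have xI : x \in interface P.
  apply/memv_capP; split=> //; rewrite -[x](addrK c) -e memvB //.
    by apply: subvP aA; apply: spS; rewrite setCS.
  by apply: subvP cC; apply: spS; clear -sC; set_dec.
have x0 : x \in (interface P :&: lker p)%VS.
  by apply/memv_capP; split=> //; move: ka; rewrite !memv_ker e linearD /= pc addr0.
rewrite -(interface_skew cA); apply/memv_capP; split=> //.
move: x0; rewrite kerP memv0 e => /eqP->; rewrite add0r.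
by apply: subvP cC; apply: spS; apply: subsetIl.
Qed.

Variable p : 'Hom(V, 'rV[F]_m).
Hypothesis fp : frame p.

(** What the right of a cut can see of the set [twist C Z], in coordinates, when
    [Z] lies on the left.  The definition uses the last cut [S]; the next lemma
    shows that every cut with [Z] on its left gives the same subspace. *)
Definition state (Z : {set T}) : {vspace 'rV[F]_m} :=
  (p @: (sp v (twist C Z) :&: sp v (~: S)))%VS.

Lemma state_cut (A Z : {set T}) : cut (vrank v) m P S A -> Z \subset A ->
  state Z = (p @: (sp v (twist C Z :&: A) :&: sp v (~: A)))%VS.
Proof.
move=> cA sZ; have [_ eA _ _ _] := cut_spans cA; have [kC _] := fp.
rewrite eA -limg_shift; last first.
  by apply: subv_trans kC; apply: spS; apply: subsetDl.
rewrite -spU; suff -> : twist C Z :&: A :|: C :\: A = twist C Z by [].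
by clear -sZ; set_dec.
Qed.

(** The left and right traces on the interface determine the interaction of the
    two sides, because [p] is injective on the interface. *)
Lemma meet_states (A X Y : {set T}) : cut (vrank v) m P S A ->
  X \subset A -> Y \subset ~: A ->
  \dim (sp v X :&: sp v Y) =
  \dim ((p @: (sp v X :&: sp v (~: A))) :&: (p @: (sp v Y :&: sp v A))).
Proof.
move=> cA /(spS v) sX /(spS v) sY; have [_ /(_ A cA) inj] := fp.
have sX' : (sp v X :&: sp v (~: A) <= interface A)%VS by rewrite capvS.
have sY' : (sp v Y :&: sp v A <= interface A)%VS by rewrite capvC capvS.
rewrite -(limg_cap_inj inj sX' sY') limg_dim_eq; last first.
  by apply/eqP; rewrite -subv0 -inj capvS // (subv_trans (capvSl _ _)).
congr (\dim _); apply/eqP; rewrite eqEsubv; apply/andP; split.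
  by rewrite !subv_cap capvSl capvSr (subv_trans (capvSr _ _) sY) (subv_trans (capvSl _ _) sX).
by rewrite subv_cap (subv_trans (capvSl _ _)) ?capvSl // (subv_trans (capvSr _ _)) ?capvSl.
Qed.

Lemma twist_split (A Z W : {set T}) : Z \subset A -> W \subset ~: A ->
  twist C (Z :|: W) = (twist C Z :&: A) :|: (twist C W :\: A).
Proof. by move=> sZ sW; set_dec. Qed.

Lemma vrank_left (A Z : {set T}) : cut (vrank v) m P S A -> Z \subset A ->
  vrank v (twist C Z) = vrank v (twist C Z :&: A) + vrank v (C :\: A).
Proof.
move=> cA sZ; have [_ _ sk _ _] := cut_spans cA.
have := dim_interface (twist C Z :&: A) (C :\: A).
have -> : twist C Z :&: A :|: C :\: A = twist C Z by clear -sZ; set_dec.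
suff -> : (sp v (twist C Z :&: A) :&: sp v (C :\: A) = 0)%VS.
  by rewrite dimv0 addn0.
by apply/eqP; rewrite -subv0 -sk capvS // spS // subsetIr.
Qed.

Lemma vrank_join (A Z W : {set T}) : cut (vrank v) m P S A ->
  Z \subset A -> W \subset ~: A ->
  vrank v (twist C (Z :|: W)) +
    \dim (state Z :&: (p @: (sp v (twist C W :\: A) :&: sp v A))) =
  vrank v (twist C Z :&: A) + vrank v (twist C W :\: A).
Proof.
move=> cA sZ sW; rewrite (twist_split sZ sW) (state_cut cA sZ) -meet_states //.
- exact: dim_interface.
- exact: subsetIr.
by rewrite setDE subsetIr.
Qed.

(** Sets with equal states on the left of a cut are interchangeable: every
    completion on the right raises their ranks by the same amount. *)
Lemma state_congr (A Z Z' W : {set T}) : cut (vrank v) m P S A ->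
  Z \subset A -> Z' \subset A -> W \subset ~: A -> state Z = state Z' ->
  vrank v (twist C (Z :|: W)) + vrank v (twist C Z') =
  vrank v (twist C (Z' :|: W)) + vrank v (twist C Z).
Proof.
move=> cA sZ sZ' sW e.
have := vrank_join cA sZ sW; have := vrank_join cA sZ' sW.
by rewrite e (vrank_left cA sZ) (vrank_left cA sZ'); lia.
Qed.

End States.

(** * Gluing two representations *)

Section Glue.
Variables (F : fieldType) (m : nat) (V1 V2 : vectType F).
Variables (p1 : 'Hom(V1, 'rV[F]_m)) (p2 : 'Hom(V2, 'rV[F]_m)).
Variables (D1 : {vspace V1}) (D2 : {vspace V2}).
Hypotheses (inj1 : (D1 :&: lker p1 = 0)%VS) (inj2 : (D2 :&: lker p2 = 0)%VS).

(** The amalgam of [V1] and [V2] in which a vector of [D1] is identified with a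
    vector of [D2] when [p1] and [p2] send them to the same coordinates.  It is
    realised inside a product: each vector is split into its coordinates and its
    component in a complement of the interface. *)
Lemma amalgam : exists (V : vectType F) (g1 : 'Hom(V1, V)) (g2 : 'Hom(V2, V)),
  [/\ lker g1 = 0%VS, lker g2 = 0%VS &
  forall (X : {vspace V1}) (Y : {vspace V2}),
    \dim (g1 @: X :&: g2 @: Y) =
    \dim ((p1 @: (X :&: D1)) :&: (p2 @: (Y :&: D2)))].
Proof.
pose V : vectType F := ('rV[F]_m * (V1 * V2))%type.
pose f1 (x : V1) : V := (p1 (projv D1 x), (x - projv D1 x, 0))%R.
pose f2 (y : V2) : V := (p2 (projv D2 y), (0, y - projv D2 y))%R.
pose f0 (t : 'rV[F]_m) : V := (t, (0, 0))%R.
have l1 : linear f1.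
  move=> a x y; rewrite /f1 (linearP (projv D1)) (linearP p1).
  by congr (_, (_, _)); rewrite /= ?scaler0 ?addr0 // opprD addrACA -scalerBr.
have l2 : linear f2.
  move=> a x y; rewrite /f2 (linearP (projv D2)) (linearP p2).
  by congr (_, (_, _)); rewrite /= ?scaler0 ?addr0 // opprD addrACA -scalerBr.
have l0 : linear f0.
  by move=> a x y; rewrite /f0; congr (_, (_, _)); rewrite /= scaler0 addr0.
have [L1 E1] := lfun_of_linear l1.
have [L2 E2] := lfun_of_linear l2.
have [L0 E0] := lfun_of_linear l0.
have on1 x : x \in D1 -> f1 x = f0 (p1 x).
  by move=> xD; rewrite /f1 projv_id // subrr.
have on2 x : x \in D2 -> f2 x = f0 (p2 x).
  by move=> xD; rewrite /f2 projv_id // subrr.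
exists V, L1, L2; split.
- apply/eqP; rewrite -subv0; apply/subvP=> x; rewrite memv_ker E1 memv0.
  rewrite -!pair_eqE /= => /andP[k1 /andP[/eqP/subr0_eq e _]].
  by rewrite e -memv0 -inj1 memv_cap memv_proj memv_ker.
- apply/eqP; rewrite -subv0; apply/subvP=> x; rewrite memv_ker E2 memv0.
  rewrite -!pair_eqE /= => /andP[k1 /andP[_ /eqP/subr0_eq e]].
  by rewrite e -memv0 -inj2 memv_cap memv_proj memv_ker.
move=> X Y.
rewrite -(@limg_dim_eq _ _ _ L0 (_ :&: _)); last first.
  apply/eqP; rewrite -subv0; apply/subvP=> x /memv_capP[_]; rewrite memv_ker E0.
  by rewrite -pair_eqE /= memv0 => /andP[].
congr (\dim _); apply/eqP; rewrite eqEsubv; apply/andP; split; apply/subvP.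
  move=> _ /memv_capP[/memv_imgP[x xX ->] /memv_imgP[y yY]].
  rewrite E1 E2 /f1 /f2 => -[e0 e1 e2].
  have xD : x \in D1 by rewrite (subr0_eq e1) memv_proj.
  have yD : y \in D2 by rewrite (subr0_eq (esym e2)) memv_proj.
  move: e0; rewrite !projv_id // => e0.
  rewrite subrr -[(_, _)]/(f0 (p1 x)) -E0; apply: memv_img; apply/memv_capP.
  split; first by apply: memv_img; apply/memv_capP.
  by rewrite e0; apply: memv_img; apply/memv_capP.
move=> _ /memv_imgP[t /memv_capP[/memv_imgP[x /memv_capP[xX xD] ex]
  /memv_imgP[y /memv_capP[yY yD] ey]] ->].
rewrite E0; apply/memv_capP; split.
  by rewrite ex -on1 // -E1 memv_img.
by rewrite ey -on2 // -E2 memv_img.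
Qed.

End Glue.

Section GlueRepresentations.
Variables (F : fieldType) (T : finType) (m : nat) (P S C A : {set T}).
Variables (V1 : vectType F) (v1 : T -> V1) (p1 : 'Hom(V1, 'rV[F]_m)).
Variables (V2 : vectType F) (v2 : T -> V2) (p2 : 'Hom(V2, 'rV[F]_m)).
Hypotheses (lk1 : linked (vrank v1) m P S C) (lk2 : linked (vrank v2) m P S C).
Hypotheses (fr1 : frame v1 P S C p1) (fr2 : frame v2 P S C p2).
Hypotheses (ct1 : cut (vrank v1) m P S A) (ct2 : cut (vrank v2) m P S A).
Hypothesis eC : vrank v1 (C :\: A) = vrank v2 (C :\: A).
Hypothesis eB : vrank v1 (~: A) = vrank v2 (~: A).

(** Use the first representation on [A] and the second on its complement.  The
    second conclusion says that a set on the left behaves in the glued matroid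
    as a set with the same state behaves in the second representation. The
    third holds because the interface of the second representation fills the
    whole coordinate space. *)
Lemma glue : exists (V : vectType F) (w : T -> V),
  [/\ forall X : {set T}, X \subset A -> vrank w X = vrank v1 X,
      forall Z Z' W : {set T}, Z \subset A -> Z' \subset A -> W \subset ~: A ->
        state v1 S C p1 Z = state v2 S C p2 Z' ->
        vrank w (twist C (Z :|: W)) + vrank v2 (twist C Z') =
        vrank v1 (twist C Z) + vrank v2 (twist C (Z' :|: W)) &
      forall X : {set T}, X \subset A ->
        vrank w (X :|: ~: A) <= vrank v1 (X :|: ~: A)].
Proof.
have [_ /(_ A ct1) inj1] := fr1; have [_ /(_ A ct2) inj2] := fr2.
have [V [g1 [g2 [k1 k2 capE]]]] := amalgam inj1 inj2.
pose w x := if x \in A then g1 (v1 x) else g2 (v2 x).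
have w1 (X : {set T}) : X \subset A -> sp w X = (g1 @: sp v1 X)%VS.
  by move=> s; apply: sp_limg => x /(subsetP s) xA; rewrite /w xA.
have w2 (X : {set T}) : X \subset ~: A -> sp w X = (g2 @: sp v2 X)%VS.
  by move=> s; apply: sp_limg => x /(subsetP s); rewrite inE /w => /negbTE->.
have d1 (X : {vspace V1}) : \dim (g1 @: X) = \dim X.
  by apply: limg_dim_eq; rewrite k1 capv0.
have d2 (X : {vspace V2}) : \dim (g2 @: X) = \dim X.
  by apply: limg_dim_eq; rewrite k2 capv0.
have split (X Y : {set T}) : X \subset A -> Y \subset ~: A ->
    vrank w (X :|: Y) + \dim ((p1 @: (sp v1 X :&: sp v1 (~: A))) :&:
                              (p2 @: (sp v2 Y :&: sp v2 A))) =
    vrank v1 X + vrank v2 Y.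
  move=> sX sY; rewrite -[vrank v1 X]d1 -[vrank v2 Y]d2 -w1 // -w2 //.
  rewrite -dim_interface w1 // w2 // capE; congr (_ + \dim ((p1 @: _) :&: (p2 @: _))%VS).
    rewrite /interface capvA; congr (_ :&: _)%VS.
    by apply/esym/capv_idPl; apply: spS.
  rewrite /interface [(sp v2 A :&: _)%VS]capvC capvA; congr (_ :&: _)%VS.
  by apply/esym/capv_idPl; apply: spS.
exists V, w; split.
- by move=> X sX; rewrite /vrank w1 // d1.
- move=> Z Z' W sZ sZ' sW e.
  have sWA : twist C W :\: A \subset ~: A by rewrite setDE subsetIr.
  have := split (twist C Z :&: A) (twist C W :\: A) (subsetIr _ _) sWA.
  rewrite -twist_split // -(state_cut lk1 fr1 ct1 sZ) e.
  have := vrank_join lk2 fr2 ct2 sZ' sW.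
  rewrite (vrank_left lk1 ct1 sZ) (vrank_left lk2 ct2 sZ') eC.
  by move: (\dim _) => d; clear; lia.
move=> X sX; have := split X (~: A) sX (subxx _).
have -> : (p2 @: (sp v2 (~: A) :&: sp v2 A))%VS = fullv.
  apply/eqP; rewrite eqEdim subvf dimvf dim_matrix mul1r capvC.
  rewrite -/(interface v2 A) limg_dim_eq //=.
  by have [_ _ _ _ ->] := cut_spans lk2 ct2.
rewrite capvf limg_dim_eq; last first.
  by apply/eqP; rewrite -subv0 -inj1 capvS // /interface capvS // spS.
have := dim_interface v1 X (~: A).
by rewrite eB; lia.
Qed.

End GlueRepresentations.

(** * Finding two compatible representations *)

Section Core.
Variables (T Om : finType) (n N : nat).
Variables (A : nat -> {set T}) (e : nat -> T) (f : {set T} -> nat).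
Variables (u : nat -> {set T} -> 'I_n) (om : {set T} -> Om).
Hypothesis A_mono : forall s t, s <= t -> t < N -> A s \subset A t.
Hypothesis e_notin : forall s, s < N -> e s \notin A s.
Hypothesis e_in : forall s t, s < t -> t < N -> e s \in A t.
Hypothesis u_congr : forall s l (Z Z' W : {set T}), s < N -> l < N ->
  Z \subset A l -> Z' \subset A l -> W \subset ~: A l ->
  e s \notin Z -> e s \notin Z' -> e s \notin W -> u s Z = u s Z' ->
  f (Z :|: W) + f Z' = f (Z' :|: W) + f Z.

(** The compatibility needed to glue the representation with index [j], used on
    the left of cut [l], to the one with index [i], used on the right.  For sets
    to the left of cut [a], the second clause finds a substitute that behaves the
    same in the matroid and has in representation [i] the state which the set has
    in representation [j].  The last clause pulls sets back from cut [l] to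
    cut [a] without changing their state in [j] or their outer state. *)
Definition splice (a i l j : nat) : Prop :=
  [/\ [/\ a <= i, i < l, l <= j & j < N],
      forall Z : {set T}, Z \subset A a -> exists2 Z' : {set T}, Z' \subset A a &
        u i Z' = u j Z /\ forall W : {set T}, W \subset ~: A l ->
          f (Z' :|: W) + f Z = f (Z :|: W) + f Z' &
      forall Z : {set T}, Z \subset A l -> exists2 Z' : {set T}, Z' \subset A a &
        u j Z' = u j Z /\ om Z' = om Z].

(** One more block than there are relations on ['I_n], and an initial block that
    serves as a reference. *)
Definition core_base : nat := (2 ^ (n * n)).+2.
Local Notation K := core_base.

(** Grows with [l], as there are more sets to the left of a later cut. *)
Let profile (j l : nat) : {set 'I_n * Om} :=
  [set (u j Z, om Z) | Z : {set T} in [set Z : {set T} | Z \subset A l]].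

(** Induction on [d], a bound for how much the profiles at cut [x] can still
    grow.  Divide the interval into [K] blocks starting at the indices [y t].  If
    in some block all profiles have grown between cuts [x] and [y t], continue
    inside that block.  Otherwise every block contains an index [j t] whose
    profile has not grown, and two of the relations between the states in
    [j ord0] and in [j t] coincide.  States in [j ord0] decide behaviour towards
    the right of all later blocks, so these two indices can be spliced. *)
Lemma splice_rec d x : x + K ^ d.+1 <= N ->
  (forall j, x <= j < x + K ^ d.+1 ->
     #|{: 'I_n * Om}| <= #|profile j x| + d) ->
  exists a i l j, splice a i l j.
Proof.
move: d x; apply: ltn_ind => d IH x xN big.
pose y (t : 'I_K) := x + t * K ^ d.
have Kpos : 0 < K ^ d by rewrite expn_gt0.
have y_next (s t : 'I_K) : s < t -> y s + K ^ d <= y t.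
  by move=> st; rewrite /y -addnA leq_add2l -mulSnr leq_mul2r st orbT.
have yN (t : 'I_K) : y t + K ^ d <= x + K ^ d.+1.
  by rewrite /y -addnA leq_add2l -mulSnr expnS leq_mul2r ltn_ord orbT.
have xy (t : 'I_K) : x <= y t by apply: leq_addr.
have prof_sub (j l l' : nat) : l <= l' -> l' < N -> profile j l \subset profile j l'.
  move=> ll l'N; apply/subsetP=> c /imsetP[Z]; rewrite inE => sZ ->.
  by apply/imsetP; exists Z; rewrite // inE (subset_trans sZ) ?A_mono.
have [/existsP[t /forallP grow]|] := boolP [exists t : 'I_K,
    [forall o : 'I_(K ^ d), profile (y t + o) (y t) != profile (y t + o) x]].
  have gt j : y t <= j < y t + K ^ d -> #|profile j x| < #|profile j (y t)|.
    move=> /andP[lj jl]; have oP : j - y t < K ^ d by lia.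
    have := grow (Ordinal oP); rewrite /= subnKC // => ne.
    apply: proper_card; rewrite properEneq eq_sym ne prof_sub //.
    by have := yN t; have := xy t; lia.
  have gt' j : y t <= j < y t + K ^ d ->
      #|{: 'I_n * Om}| < #|profile j (y t)| + d.
    move=> jt; have := gt j jt; have : x <= j < x + K ^ d.+1.
      by have := yN t; have := xy t; lia.
    by move/big; lia.
  have [d0|d0] := posnP d.
    have : y t <= y t < y t + K ^ d by rewrite leqnn /= -addn1 leq_add2l.
    by move/gt'; rewrite d0 addn0 ltnNge max_card.
  apply: (IH d.-1 _ (y t)); rewrite ?prednK //; first by have := yN t; lia.
  by move=> j /gt'; lia.
rewrite negb_exists => /forallP h.
have {h} : forall t : 'I_K, exists o : 'I_(K ^ d), profile (y t + o) (y t) = profile (y t + o) x.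
  move=> t; have := h t; rewrite negb_forall => /existsP[o].
  by rewrite negbK => /eqP; exists o.
case/fin_all_exists=> o oP; pose j t := y t + o t.
have jy (s t : 'I_K) : s < t -> j s < y t.
  by move=> /y_next; rewrite /j; have := ltn_ord (o s); lia.
have jN t : j t < N by rewrite /j; have := ltn_ord (o t); have := yN t; lia.
have yj t : y t <= j t by apply: leq_addr.
have xN' t : y t < N by apply: leq_ltn_trans (jN t).
pose typ (t : 'I_K) : {set 'I_n * 'I_n} :=
  [set (u (j ord0) Z, u (j t) Z) | Z : {set T} in [set Z : {set T} | Z \subset A x]].
(* The reference block ord0 is left out of the comparison. *)
have : ~~ injectiveb (fun t : 'I_K.-1 => typ (lift ord0 t)).
  apply/negP=> /injectiveP/leq_card.
  by rewrite card_ord -cardsT -powersetT card_powerset cardsT card_prod !card_ord ltnn.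
case/injectivePn=> s [t].
wlog st : s t / s < t.
  move=> wl st; have [lt|gt] : s < t \/ t < s.
    by move: st; rewrite -val_eqE /=; lia.
    exact: wl.
  by move=> /esym; apply: wl; rewrite 1?eq_sym.
move=> _ eT; exists x, (j (lift ord0 s)), (y (lift ord0 t)), (j (lift ord0 t)).
have lt : lift ord0 s < lift ord0 t by rewrite !lift0.
have lt0 : (ord0 : 'I_K) < lift ord0 t by rewrite lift0.
split.
- by split; [exact: leq_trans (xy _) (yj _) | exact: jy | exact: yj | exact: jN].
- move=> Z sZ.
  have : (u (j ord0) Z, u (j (lift ord0 t)) Z) \in typ (lift ord0 s).
    by rewrite eT; apply/imsetP; exists Z; rewrite ?inE.
  case/imsetP=> Z'; rewrite inE => sZ' [e0 e1]; exists Z' => //; split=> // W sW.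
  have sx : A x \subset A (j ord0) by apply: A_mono => //; apply: leq_trans (xy ord0) (yj _).
  have sxy : A x \subset A (y (lift ord0 t)) by apply: A_mono.
  have nA : e (j ord0) \notin A x.
    by apply: contra (e_notin (jN ord0)); apply: (subsetP sx).
  apply: (@u_congr (j ord0) (y (lift ord0 t))) => //.
  + exact: subset_trans sxy.
  + exact: subset_trans sxy.
  + by apply: contra nA; apply: (subsetP sZ').
  + by apply: contra nA; apply: (subsetP sZ).
  apply: contraL (e_in (jy _ _ lt0) (xN' _)) => eW.
  by have := subsetP sW _ eW; rewrite inE.
move=> Z sZ; have : (u (j (lift ord0 t)) Z, om Z) \in profile (j (lift ord0 t)) x.
  by rewrite -oP; apply/imsetP; exists Z; rewrite ?inE.
by case/imsetP=> Z'; rewrite inE => sZ' [-> ->]; exists Z'.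
Qed.

Lemma splice_exists :
  K ^ (n * #|Om|).+1 <= N -> exists a i l j, splice a i l j.
Proof.
move=> le; apply: (@splice_rec (n * #|Om|) 0) => // j _.
by rewrite card_prod card_ord leq_addl.
Qed.

End Core.

(** * One-element minors *)

Section OneElementMinors.
Variables (T : finType) (r : {set T} -> nat).
Hypothesis hr : rank_fun r.

(** The one-element minor at [x], contracted if [b] and deleted otherwise, with
    [x] put back as a coloop or as a loop.  In this way minors and matroid have
    the same elements, and their ranks agree on every set in which membership of
    [x] follows [b] (lemma [minor_rank_agree]). *)
Definition minor_rank (x : T) (b : bool) (Q : {set T}) : nat :=
  if b then r (x |: Q) - (x \notin Q) else r (Q :\ x).

Lemma minor_rank_le x b Q : minor_rank x b Q <= r Q.
Proof.
rewrite /minor_rank; case: b; last exact: (rf_mono hr (subD1set _ _)).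
have := rf_addU1 hr x Q; case: (boolP (x \in Q)) => [xQ _|_] /=; last by lia.
by rewrite (setUidPr _) ?sub1set // subn0.
Qed.

Lemma minor_rank_agree x b (Q : {set T}) : (x \in Q) = b -> minor_rank x b Q = r Q.
Proof.
rewrite /minor_rank => <-; case: (boolP (x \in Q)) => xQ /=.
  by rewrite subn0 (setUidPr _) ?sub1set.
suff -> : Q :\ x = Q by [].
by apply/setDidPl; rewrite disjoint_sym disjoints1.
Qed.

Variables (m : nat) (P S C : {set T}).
Hypothesis lk : linked r m P S C.

Lemma dominated_linked (R : {set T} -> nat) :
  (forall Q, R Q <= r Q) -> R setT = r setT ->
  R (P :|: C) = r (P :|: C) -> R (~: S :|: C) = r (~: S :|: C) ->
  linked R m P S C.
Proof.
move=> le eT eP eS; have [sC h] := lk; split=> //.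
by rewrite eT eP eS; have := le C; lia.
Qed.

Lemma dominated_cut (R : {set T} -> nat) (A : {set T}) :
  (forall Q, R Q <= r Q) -> R setT = r setT ->
  cut r m P S A -> cut R m P S A.
Proof.
move=> le eT [sP sA h]; split=> //.
by rewrite eT; have := le A; have := le (~: A); lia.
Qed.

(** Treating an element between the ends as [C] prescribes preserves the
    linking. *)
Lemma gap_minor (x : T) : cut r m P S S -> x \in S :\: P ->
  [/\ minor_rank x (x \in C) setT = r setT,
      minor_rank x (x \in C) (P :|: C) = r (P :|: C),
      minor_rank x (x \in C) (~: S :|: C) = r (~: S :|: C) &
      forall X : {set T}, X \subset C -> (x \in C) = (x \in X) ->
        minor_rank x (x \in C) X = r X].
Proof.
move=> cS; rewrite inE => /andP[xP xS]; split; last 1 first.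
- by move=> X _ e; apply: minor_rank_agree.
- have [xC|xC] := boolP (x \in C); first by rewrite minor_rank_agree ?inE.
  have [[e _ _ _] _] := linked_cutP hr lk cS.
  have s1 : P :|: C :&: S \subset S :\ x.
    have [sP _ _] := cS.
    apply/subsetP=> z; rewrite !inE => /orP[zP|/andP[zC zS]].
      by rewrite (subsetP sP _ zP) andbT; apply: contraNneq xP => <-.
    by rewrite zS andbT; apply: contraNneq xC => <-.
  have eS : r (S :\ x) = r S.
    have := rf_mono hr s1; have := rf_mono hr (subD1set S x).
    by rewrite e; lia.
  have := rf_same_span hr (~: S) (subD1set S x) eS.
  rewrite [~: S :|: S]setUC setUCr /minor_rank => <-; congr r.
  apply/setP=> z; rewrite !inE andbT.
  by case: (eqVneq z x) => [->|] /=; rewrite ?xS //; case: (z \in S).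
- by apply: minor_rank_agree; rewrite inE (negbTE xP).
- by apply: minor_rank_agree; rewrite !inE xS.
Qed.

(** Contracting ([b = true]) or deleting an element [x] of the end [P] keeps the
    connectivity between the ends if [x] is outside the closure of [~: P], or
    respectively is not a coloop of the restriction to [P]. *)
Definition valid (x : T) (b : bool) : bool :=
  if b then r (x |: ~: P) != r (~: P) else r (P :\ x) == r P.

Lemma end_minor (x : T) (b : bool) :
  P \subset S -> x \in P -> valid x b ->
  [/\ minor_rank x b setT = r setT,
      minor_rank x b (P :|: C) = r (P :|: C) &
      minor_rank x b (~: S :|: C) = r (~: S :|: C)].
Proof.
move=> sPS xP; have [sC _] := lk.
have xC : x \notin C by apply: contraL xP => /(subsetP sC); rewrite inE => /andP[].
have xS : x \in S by apply: (subsetP sPS).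
case: b => v; rewrite /valid in v; last move/eqP in v.
  split; [by rewrite minor_rank_agree ?inE | by rewrite minor_rank_agree ?inE ?xP |].
  rewrite /minor_rank !inE xS (negbTE xC) /=.
  have sub : ~: S :|: C \subset ~: P by clear -sC sPS; set_dec.
  have := rf_marginal hr [set x] sub; rewrite !(setUC _ [set x]).
  have := rf_addU1 hr x (~: S :|: C); have := rf_mono hr (subsetUr [set x] (~: P)).
  by move: v; lia.
split; last by rewrite minor_rank_agree ?inE ?xS ?(negbTE xC).
- have := rf_same_span hr (~: P) (subD1set P x) v.
  rewrite [~: P :|: P]setUC setUCr /minor_rank => <-; congr r.
  apply/setP=> z; rewrite !inE andbT.
  by case: (eqVneq z x) => [->|] /=; rewrite ?xP //; case: (z \in P).
have := rf_same_span hr C (subD1set P x) v.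
rewrite setUC [C :|: P]setUC /minor_rank => <-; congr r.
apply/setP=> z; rewrite !inE.
by case: (eqVneq z x) => [->|] /=; rewrite ?(negbTE xC).
Qed.

(** Comparing [R] with [r] on a set [Q] for which no element of [X0] is suitable.
    If more than [m] elements of [X0] belong to [Q], they lie in the closures of
    both [P] and [~: P], which meet in rank at most [m]; so one of them is
    redundant in [Q], and dropping it gives a set for which it is suitable.
    Otherwise more than [m] elements of [X0] lie outside [Q].  They are coloops of
    the restriction to [P], and as [P] has connectivity at most [m], one of them
    is outside the closure of what remains without them; adding it to [Q] raises
    both ranks by one and gives a set for which it is suitable. *)
Lemma end_correction (R : {set T} -> nat) (X0 : {set T}) :
  rank_fun R -> X0 \subset P -> 2 * m < #|X0| ->
  r P + r (~: P) <= r setT + m ->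
  (forall (Q : {set T}) x, x \in X0 -> valid x (x \in Q) -> R Q = r Q) ->
  (forall X : {set T}, X \subset P -> R X = r X) ->
  (forall D : {set T}, D \subset X0 -> R (~: D) <= r (~: D)) ->
  forall Q, R Q = r Q.
Proof.
move=> hR sX0 cX0 cP H1 H2 H3 Q.
have [/exists_inP[x xX vx]|] := boolP [exists x in X0, valid x (x \in Q)].
  exact: H1 vx.
rewrite negb_exists => /forallP bad.
have {}bad x : x \in X0 -> ~~ valid x (x \in Q).
  by move=> xX; have := bad x; rewrite xX.
have [big|small] := ltnP m #|X0 :&: Q|.
  have sXP : X0 :&: Q \subset P by clear -sX0; set_dec.
  have sp : r (~: P :|: (X0 :&: Q)) = r (~: P).
    apply: (rf_span hr) => y; rewrite inE => /andP[yX yQ].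
    by have := bad y yX; rewrite yQ negbK => /eqP.
  have rX : r (X0 :&: Q) < #|X0 :&: Q|.
    have := rf_submod hr P (~: P :|: X0 :&: Q).
    rewrite sp setUA setUCr setTU setIUr setICr set0U (setIidPr sXP); lia.
  have [x] := rf_redundant hr rX; rewrite inE => /andP[xX xQ] ex.
  have sub1 : X0 :&: Q :\ x \subset X0 :&: Q by apply: subD1set.
  have vx : valid x (x \in Q :\ x).
    rewrite !inE eqxx /=; apply/eqP.
    have sub : X0 :&: Q :\ x \subset P :\ x by rewrite setSD.
    have := rf_marginal hr [set x] sub; rewrite !(setUC _ [set x]).
    rewrite !setD1K ?inE ?xX ?(subsetP sX0) // ex.
    have := rf_mono hr (subD1set P x); lia.
  have eQ (g : {set T} -> nat) : rank_fun g -> g (X0 :&: Q :\ x) = g (X0 :&: Q) ->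
      g Q = g (Q :\ x).
    move=> hg e; have := rf_same_span hg (Q :\ x) sub1 e.
    have -> : Q :\ x :|: (X0 :&: Q :\ x) = Q :\ x.
      by apply/setUidPl; rewrite setSD // subsetIr.
    move=> ->; congr g; apply/setP=> z; rewrite !inE.
    by case: (eqVneq z x) => [->|] /=; rewrite ?xX ?xQ //; case: (z \in Q); rewrite ?andbF.
  rewrite (eQ r hr ex) (eQ R hR) ?(H1 _ _ xX vx) // !H2 //.
  exact: subset_trans sub1 sXP.
pose D := X0 :\: Q.
have cD : m < #|D| by have := cardsID Q X0; rewrite -/D; lia.
have sDP : D \subset P by rewrite /D; clear -sX0; set_dec.
have col x : x \in D -> r (P :\ x) < r P.
  rewrite inE => /andP[xQ xX]; have := bad x xX; rewrite (negbTE xQ) /= => ne.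
  by rewrite ltn_neqAle ne (rf_mono hr) ?subD1set.
have := rf_coloops hr sDP col => hcol.
have ltD : r (~: D) < r setT.
  have := rf_subadd hr (P :\: D) (~: P).
  have -> : P :\: D :|: ~: P = ~: D by clear -sDP; set_dec.
  by lia.
have [x xD gx] : exists2 x, x \in D & r (~: D) < r (x |: ~: D).
  apply/exists_inP; apply: contraLR ltD; rewrite negb_exists => /forallP h.
  have := @rf_span _ _ hr (~: D) D; rewrite setUC setUCr => ->; first by rewrite ltnn.
  move=> y yD; have := h y; rewrite yD /= -leqNgt => le.
  by apply/eqP; rewrite eqn_leq le (rf_mono hr) ?subsetUr.
have /andP[xQ xX] : (x \notin Q) && (x \in X0) by rewrite inE in xD.
have vx (Y : {set T}) : x \in Y -> valid x (x \in Y).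
  move=> ->; rewrite /valid neq_ltn; apply/orP; right.
  have sub : ~: P \subset ~: D by rewrite setCS.
  by have := rf_marginal hr [set x] sub; rewrite !(setUC _ [set x]); lia.
have step (g : {set T} -> nat) : rank_fun g -> g (~: D) < g (x |: ~: D) ->
    g (x |: Q) = (g Q).+1.
  move=> hg lt; have sub : Q \subset ~: D by rewrite /D; set_dec.
  have := rf_marginal hg [set x] sub; rewrite !(setUC _ [set x]).
  by have := rf_addU1 hg x Q; lia.
have RD : R (~: D) < R (x |: ~: D).
  rewrite (H1 (x |: ~: D) x) ?vx ?setU11 //.
  by apply: leq_ltn_trans gx; apply: H3; apply: subsetDl.
apply: succn_inj; rewrite -(step R) // -(step r) //.
by apply: (H1 _ x) => //; apply: vx; apply: setU11.
Qed.

End OneElementMinors.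

(** * Representations of one-element minors *)

Section Representations.
Variables (T : finType) (M : matroid T).

Definition total_rank (Q : {set T}) : nat := rank M (Q :&: ground M).

Lemma total_rankP : rank_fun total_rank.
Proof.
rewrite /total_rank; split=> [X|X Y sXY|X Y].
- by apply: leq_trans (rank_le_card (subsetIr _ _)) _; apply/subset_leq_card/subsetIl.
- by apply: rank_mono; rewrite ?setSI ?subsetIr.
have := rank_submod (subsetIr X (ground M)) (subsetIr Y (ground M)).
by rewrite -setIUl -setIIl.
Qed.

Lemma representable_of_vrank (F : fieldType) (V : vectType F) (v : T -> V) :
  (forall Q, vrank v Q = total_rank Q) -> representable F M.
Proof.
move=> h; have [p [_ pK]] := frame_map (capv0 (fullv : {vspace V})) (leqnn _).
pose g (x : V) : 'cV[F]_(\dim (fullv : {vspace V})) := ((p x)^T)%R.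
have lg : linear g by move=> a x y; rewrite /g !linearP.
have [L LE] := lfun_of_linear lg.
exists (\dim (fullv : {vspace V})), (L \o v) => X sX.
have := h X; rewrite /total_rank (setIidPl sX) => <-.
rewrite -/(sp (L \o v) X) (@sp_limg _ _ _ _ L v (L \o v)) //.
rewrite limg_dim_eq //; suff -> : lker L = 0%VS by rewrite capv0.
rewrite -pK; apply/vspaceP=> x.
by rewrite memv_cap !memv_ker memvf LE /g -trmx0 (inj_eq trmx_inj).
Qed.

Variables (I : Type) (F : I -> finFieldType).
Hypothesis ex : excluded_minor (family_representable F (T := T)) M.

Lemma minor_representation (x : T) (b : bool) :
  x \in ground M -> (b -> total_rank [set x] = 1) ->
  exists (c : I) (V : vectType (F c)) (v : T -> V),
    forall Q, vrank v Q = minor_rank total_rank x b Q.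
Proof.
move=> xE rx; set E := ground M in xE *.
pose C := if b then [set x] else set0 : {set T}.
pose D := if b then set0 else [set x] : {set T}.
have [_ /(_ C D)] := ex; case.
- by rewrite /C; case: (b); rewrite ?sub1set ?sub0set.
- by rewrite /D; case: (b); rewrite ?sub1set ?sub0set.
- by rewrite /C /D; rewrite -setI_eq0; case: (b); rewrite ?set0I ?setI0.
- by apply/set0Pn; exists x; rewrite /C /D; case: (b); rewrite !inE eqxx.
move=> c [n [v0 hv0]]; exists c.
have {}hv0 (Q : {set T}) : x \notin Q ->
    vrank v0 (Q :&: E) = if b then total_rank (x |: Q) - 1 else total_rank Q.
  move=> xQ; rewrite /vrank /sp -hv0 /=; last first.
    by rewrite -/E /C /D; case: (b); rewrite ?setD0 subsetD subsetIr
      disjoint_sym disjoints1 inE (negbTE xQ).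
  rewrite /contract_rank -/E /C /total_rank -/E; case: (b) rx => rx.
    have -> : E :&: [set x] = [set x] by apply/setIidPr; rewrite sub1set.
    rewrite -(rx isT) /total_rank -/E; congr (rank M _ - rank M _).
      by rewrite setUC setIUl; congr (_ :|: _); apply/esym/setIidPl; rewrite sub1set.
    by apply/esym/setIidPl; rewrite sub1set.
  have -> : E :&: set0 = set0 by rewrite setI0.
  rewrite setU0.
  have := @rank_le_card _ M set0 (sub0set _); rewrite cards0 leqn0 => /eqP->.
  by rewrite subn0.
pose V : vectType (F c) := ('cV[F c]_n * (F c)^o)%type.
pose g0 (y : 'cV[F c]_n) : V := (y, 0%R).
have lg : linear g0 by move=> a y z; rewrite /g0; congr (_, _); rewrite /= scaler0 addr0.
have [g gE] := lfun_of_linear lg.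
pose v y : V := if y == x then (0, b%:R)%R else if y \in E then g (v0 y) else 0%R.
exists V, v => Q.
have Q1 : sp v (Q :\ x) = (g @: sp v0 ((Q :\ x) :&: E))%VS.
  rewrite -(@sp_limg _ _ _ _ g v0 v); last first.
    by move=> y; rewrite !inE => /andP[/andP[yx _] yE]; rewrite /v (negbTE yx) yE.
  apply/eqP; rewrite eqEsubv; apply/andP; split; last by apply/spS/subsetIl.
  apply/sp_subP=> y yQ.
  have [yE|yE] := boolP (y \in E); first by apply: memv_sp; rewrite inE yQ.
  by move: yQ; rewrite !inE /v (negbTE yE) => /andP[/negbTE-> _]; apply: mem0v.
have kg : lker g = 0%VS.
  apply/eqP; rewrite -subv0; apply/subvP=> y; rewrite memv_ker gE memv0.
  by rewrite -pair_eqE /= => /andP[].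
have d1 : vrank v (Q :\ x) = vrank v0 ((Q :\ x) :&: E).
  by rewrite /vrank Q1 limg_dim_eq // kg capv0.
have [xQ|xQ] := boolP (x \in Q); last first.
  have QE : Q :\ x = Q by apply/setDidPl; rewrite disjoint_sym disjoints1.
  by rewrite -{1}QE d1 hv0 ?setD11 // /minor_rank QE xQ.
have dQ : vrank v Q = vrank v (Q :\ x) + b.
  have vx : v x = (0, b%:R)%R by rewrite /v eqxx.
  rewrite -{1}(setD1K xQ) /vrank spU sp1 addvC dimv_disjoint_sum.
    rewrite dim_vline vx -pair_eqE /= eqxx /=.
    by case: (b); rewrite /= ?oner_neq0 // eqxx.
  apply/eqP; rewrite -subv0; apply/subvP=> y /memv_capP[].
  rewrite Q1 => /memv_imgP[z _ ->] /vlineP[k].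
  rewrite vx gE memv0 => /(congr1 fst) /= ->.
  by rewrite scaler0.
rewrite dQ d1 hv0 ?setD11 // /minor_rank xQ subn0 (setD1K xQ).
rewrite (setUidPr _) ?sub1set //.
case: (b) rx => [/(_ isT) e|_]; last by rewrite addn0.
have := rf_mono total_rankP (_ : [set x] \subset Q); rewrite sub1set xQ e.
by move/(_ isT); lia.
Qed.

End Representations.

(** A subspace is determined by the square matrix that lists a basis of it,
    completed by zero rows. *)
Lemma subspace_code (K : finFieldType) (m n : nat) :
  #|K| ^ (m * m) <= n ->
  exists k : {vspace 'rV[K]_m} -> 'I_n, injective k.
Proof.
rewrite -card_mx => le.
pose c (U : {vspace 'rV[K]_m}) : 'M[K]_m := (\matrix_(i < m) (vbasis U)`_i)%R.
have cK U : U = <<[seq row i (c U) | i : 'I_m]>>%VS.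
  rewrite -{1}(span_basis (vbasisP U)); apply/eqP; rewrite eqEsubv.
  apply/andP; split; apply/span_subvP=> y.
    move=> /(nthP 0%R)[i]; rewrite size_tuple => lt <-.
    have im : i < m.
      by apply: leq_trans lt _; have := dimvS (subvf U); rewrite dimvf dim_matrix mul1r.
    by apply/memv_span/imageP; exists (Ordinal im); rewrite ?rowK.
  move=> /imageP[i _ ->]; rewrite rowK.
  have [lt|le'] := ltnP i (\dim U); last by rewrite nth_default ?size_tuple // mem0v.
  by apply/memv_span/mem_nth; rewrite size_tuple.
exists (fun U => widen_ord le (enum_rank (c U))) => U U' e.
have /enum_rank_inj e' : enum_rank (c U) = enum_rank (c U').
  by apply: val_inj; have := congr1 val e.
by rewrite (cK U) (cK U') e'.
Qed.

(** * Linked chains in an excluded minor *)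

Lemma bounded_choice (U : Type) (N : nat) (Q : nat -> U -> Prop) (u0 : U) :
  (forall s, s < N -> exists x, Q s x) ->
  exists g : nat -> U, forall s, s < N -> Q s (g s).
Proof.
move=> h; have {h} : forall s : 'I_N, exists x, Q s x by move=> s; apply: h.
case/fin_all_exists=> g gP.
exists (fun s => if insub s is Some i then g i else u0) => s lt.
by rewrite insubT; apply: (gP (Ordinal lt)).
Qed.

Lemma pigeonhole_class (D I : finType) (g : D -> I) (k : nat) :
  #|I| * k < #|D| -> exists c, k < #|[pred s | g s == c]|.
Proof.
move=> lt; apply/existsP; apply: contraLR lt; rewrite negb_exists -leqNgt => /forallP h.
rewrite -sum1_card (partition_big g xpredT) //=.
apply: (@leq_trans (\sum_(c : I) k)); last by rewrite sum_nat_const.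
by apply: leq_sum => c _; rewrite sum1_card leqNgt; apply: h.
Qed.

Lemma monochromatic_indices (I : finType) (G k : nat) (col : nat -> I) :
  #|I| * k < G ->
  exists c (idx : nat -> nat), forall t, t <= k ->
    [/\ idx t < G, col (idx t) = c & forall s, s < t -> idx s < idx t].
Proof.
move=> lt; have [|c big] := @pigeonhole_class 'I_G I (fun s => col s) k.
  by rewrite card_ord.
pose ss := [seq val s | s <- enum [pred s : 'I_G | col s == c]].
have sz : k < size ss by rewrite size_map -cardE.
have so : sorted ltn ss.
  apply: (subseq_sorted ltn_trans) (iota_ltn_sorted 0 G).
  by rewrite -val_enum_ord; apply: map_subseq; rewrite enumT; apply: filter_subseq.
exists c, (nth 0 ss) => t tk; have ts : t < size ss by apply: leq_ltn_trans sz.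
have : nth 0 ss t \in ss by apply: mem_nth.
case/mapP=> s; rewrite mem_enum inE => /eqP cs e; split.
- by rewrite e ltn_ord.
- by rewrite e.
move=> s' lt'; apply: (sorted_ltn_nth ltn_trans) => //.
by rewrite inE; apply: ltn_trans ts.
Qed.

(** The number of outer states: for each of [2 * m + 1] elements of the end, a
    state in each of its two minors, and membership of the element. *)
Definition outer_size (m n : nat) : nat :=
  n ^ ((2 * m).+1 * 2) * 2 ^ (2 * m).+1.

(** The number of indices that suffice for a splice.  With a single state any
    two indices can be spliced; this sharper value is what makes the final bound
    hold for [k = 1]. *)
Definition index_bound (m n : nat) : nat :=
  if n == 1 then 1 else core_base n ^ (n * outer_size m n).+1.

Section Assembly.
Variables (T : finType) (r : {set T} -> nat) (m n : nat) (P S C : {set T}).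
Hypotheses (hr : rank_fun r) (lk : linked r m P S C) (rC : r C = #|C|).
Hypotheses (cP : cut r m P S P) (cS : cut r m P S S).
Variables (I : Type) (F : I -> finFieldType).
Hypotheses (n0 : 0 < n) (Fn : forall d, #|F d| ^ (m * m) <= n).

Definition represents (d : I) (R : {set T} -> nat) : Prop :=
  exists (V : vectType (F d)) (v : T -> V), forall Q, vrank v Q = R Q.

Let sPS : P \subset S. Proof. by have [] := cP. Qed.

Let xCF (x : T) : x \in P -> x \notin C.
Proof.
by move=> xP; have [sC _] := lk; apply: contraL xP => /(subsetP sC); rewrite inE => /andP[].
Qed.

Let in_twist x (Z : {set T}) : x \notin C -> (x \in twist C Z) = (x \in Z).
Proof. by rewrite inE => /negbTE->. Qed.

(** On the sets that survive in a minor at an element of the end [P], the rank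
    function of the matroid itself is governed by states, even though the matroid
    is not representable; the field may differ from one minor to another. *)
Lemma end_state (x : T) (b : bool) : x \in P -> valid r P x b ->
  (exists d, represents d (minor_rank r x b)) ->
  exists u : {set T} -> 'I_n, forall A Z Z' W : {set T},
    cut r m P S A -> Z \subset A -> Z' \subset A -> W \subset ~: A ->
    (x \in Z) = b -> (x \in Z') = b -> u Z = u Z' ->
    r (twist C (Z :|: W)) + r (twist C Z') = r (twist C (Z' :|: W)) + r (twist C Z).
Proof.
move=> xP vx [d [V [v vE]]]; have [e1 e2 e3] := end_minor hr lk sPS xP vx.
have le Q : vrank v Q <= r Q by rewrite vE minor_rank_le.
have lkv : linked (vrank v) m P S C by apply: (dominated_linked lk) => //; rewrite vE.
have ctv A : cut r m P S A -> cut (vrank v) m P S A.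
  by apply: dominated_cut => //; rewrite vE.
have [p fp] := frame_exists lkv (ctv _ cP).
have [k kinj] := subspace_code (Fn d).
exists (fun Z => k (state v S C p Z)) => A Z Z' W cA sZ sZ' sW xZ xZ' /kinj eu.
have := state_congr lkv fp (ctv _ cA) sZ sZ' sW eu.
have xC := xCF xP.
have xW : x \in W = false.
  apply/negbTE; apply: contraL xP => /(subsetP sW); rewrite inE.
  by apply: contra; have [sPA _ _] := cA; apply: (subsetP sPA).
by rewrite !vE !minor_rank_agree // in_twist // inE ?xZ ?xZ' ?xW orbF.
Qed.

Lemma linked_skew_end (R : {set T} -> nat) (X : {set T}) :
  rank_fun R -> linked R m P S C -> cut R m P S P -> X \subset P ->
  R (X :|: C) = R X + R C.
Proof.
move=> hR lkR cR sX; have [[_ _ e _] _] := linked_cutP hR lkR cR.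
have CP : C :\: P = C.
  by apply/setDidPl; have [sC _] := lk; have := sC; rewrite subsetD => /andP[].
by rewrite CP in e; apply: (rf_skew_sub hR) e sX.
Qed.

(** What is needed of a representation of the minor at an element [x] strictly
    between the ends, treated as [C] prescribes. *)
Record gap_rep (d : I) (x : T) (V : vectType (F d)) (v : T -> V)
    (p : 'Hom(V, 'rV[F d]_m)) : Prop := GapRep {
  gr_linked : linked (vrank v) m P S C;
  gr_cut : forall A, cut r m P S A -> cut (vrank v) m P S A;
  gr_frame : frame v P S C p;
  gr_le : forall Q, vrank v Q <= r Q;
  gr_twist : forall Z : {set T}, x \notin Z -> vrank v (twist C Z) = r (twist C Z);
  gr_indep : forall A : {set T}, vrank v (C :\: A) = #|C :\: A|;
  gr_right : forall A : {set T}, cut r m P S A ->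
    vrank v (~: A) + #|C :&: A| = r (~: S :|: C);
  gr_end : forall X : {set T}, X \subset P -> vrank v X = r X
}.

Lemma gap_rep_exists (d : I) (x : T) :
  x \in S :\: P -> represents d (minor_rank r x (x \in C)) ->
  exists (V : vectType (F d)) (v : T -> V) (p : 'Hom(V, 'rV[F d]_m)),
    gap_rep x v p.
Proof.
move=> xSP [V [v vE]]; have [e1 e2 e3 e4] := gap_minor hr lk cS xSP.
have le Q : vrank v Q <= r Q by rewrite vE minor_rank_le.
have lkv : linked (vrank v) m P S C by apply: (dominated_linked lk) => //; rewrite vE.
have ctv A : cut r m P S A -> cut (vrank v) m P S A.
  by apply: dominated_cut => //; rewrite vE.
have [p fp] := frame_exists lkv (ctv _ cP).
have vC : vrank v C = #|C| by rewrite vE e4.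
exists V, v, p; split=> //.
- move=> Z xZ; rewrite vE minor_rank_agree // inE (negbTE xZ) addbF //.
- by move=> A; apply: (rf_indep_sub (vrankP v) vC (subsetDl _ _)).
- move=> A /ctv cA; have [_ [_ _ _ e]] := linked_cutP (vrankP v) lkv cA.
  rewrite -(rf_indep_sub (vrankP v) vC (subsetIl _ _)) -e vE e3 //.
move=> X sX; have : vrank v (X :|: C) = r (X :|: C).
  rewrite vE minor_rank_agree // inE.
  have /negbTE-> : x \notin X; last by [].
  by apply: contraL xSP => /(subsetP sX) xP; rewrite inE xP.
rewrite (linked_skew_end hr lk cP sX) rC.
by rewrite (linked_skew_end (vrankP v) lkv (ctv _ cP) sX) vC; lia.
Qed.

Variable d : I.
Variables (N : nat) (A : nat -> {set T}) (e : nat -> T).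
Hypothesis bigN : index_bound m n < N.
Hypothesis bigP : 2 * m < #|P|.
Hypothesis A_cut : forall s, s < N -> cut r m P S (A s).
Hypothesis A_mono : forall s t, s <= t -> t < N -> A s \subset A t.
Hypothesis e_gap : forall s, s < N -> e s \in S :\: P.
Hypothesis e_notin : forall s, s < N -> e s \notin A s.
Hypothesis e_in : forall s t, s < t -> t < N -> e s \in A t.
Hypothesis gaps : forall s, s < N ->
  represents d (minor_rank r (e s) (e s \in C)).
Hypothesis ends : forall x b, x \in P -> valid r P x b ->
  exists d', represents d' (minor_rank r x b).

(** The minors at the elements [e s], all represented over the same field, yield
    two that can be glued.  The glued matroid agrees with [r]: by [end_correction]
    it suffices to consider a set that survives in a minor at an element of the
    end.  The part [Z] of its deviation to the left of the cut is replaced by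
    [Z'], far to the left, with the same state in that minor and in the first
    representation, and then by [Z''], which the second representation can
    evaluate as it avoids both elements [e i] and [e j]. *)
Lemma assemble : represents d r.
Proof.
have [k kinj] := subspace_code (Fn d).
have /card_gt0P[x0 x0P] : 0 < #|P| by apply: leq_ltn_trans bigP.
pose x_ (i : 'I_(2 * m).+1) := nth x0 (enum P) i.
have szP : (2 * m).+1 <= size (enum P) by rewrite -cardE.
have xP i : x_ i \in P.
  by rewrite -mem_enum; apply: mem_nth; apply: leq_trans szP.
have xinj : injective x_.
  move=> i i' /eqP; rewrite nth_uniq ?enum_uniq ?(leq_trans _ szP) // => /eqP.
  exact: val_inj.
pose X0 := [set x_ i | i : 'I_(2 * m).+1].
have cX0 : 2 * m < #|X0| by rewrite card_imset // card_ord.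
have sX0 : X0 \subset P by apply/subsetP=> _ /imsetP[i _ ->].
pose u0 (Z : {set T}) := Ordinal n0.
pose outer (y : 'I_(2 * m).+1 * bool) (u : {set T} -> 'I_n) :=
  valid r P (x_ y.1) y.2 -> forall A Z Z' W : {set T},
    cut r m P S A -> Z \subset A -> Z' \subset A -> W \subset ~: A ->
    (x_ y.1 \in Z) = y.2 -> (x_ y.1 \in Z') = y.2 -> u Z = u Z' ->
    r (twist C (Z :|: W)) + r (twist C Z') = r (twist C (Z' :|: W)) + r (twist C Z).
have : forall y, exists u, outer y u.
  move=> y; have [vy|nv] := boolP (valid r P (x_ y.1) y.2).
    by have [u uP] := end_state (xP _) vy (ends (xP _) vy); exists u => _.
  by exists u0 => vy; rewrite vy in nv.
case/fin_all_exists=> uo uoP.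
pose om (Z : {set T}) := ([ffun y => uo y Z], [ffun i => x_ i \in Z]).
pose inner s (u : {set T} -> 'I_n) :=
  exists (V : vectType (F d)) (v : T -> V) (p : 'Hom(V, 'rV[F d]_m)),
    gap_rep (e s) v p /\ forall Z, u Z = k (state v S C p Z).
have [|u uP] := @bounded_choice _ N inner u0.
  move=> s sN; have [V [v [p rep]]] := gap_rep_exists (e_gap sN) (gaps sN).
  by exists (fun Z => k (state v S C p Z)), V, v, p.
pose f Z := r (twist C Z).
have u_congr s l (Z Z' W : {set T}) : s < N -> l < N ->
    Z \subset A l -> Z' \subset A l -> W \subset ~: A l ->
    e s \notin Z -> e s \notin Z' -> e s \notin W -> u s Z = u s Z' ->
    f (Z :|: W) + f Z' = f (Z' :|: W) + f Z.
  move=> sN lN sZ sZ' sW eZ eZ' eW; have [V [v [p [rep uE]]]] := uP s sN.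
  rewrite !uE => /kinj eu.
  have := state_congr (gr_linked rep) (gr_frame rep) (gr_cut rep (A_cut lN)) sZ sZ' sW eu.
  by rewrite !(gr_twist rep) ?inE ?negb_or ?eZ ?eZ' ?eW.
have [a [i [l [j [[ai il lj jN] alpha beta]]]]] :
    exists a i l j, splice N A f u om a i l j.
  have [n1|n1] := eqVneq n 1.
    have one (c c' : 'I_n) : c = c'.
      case: c c' => [c lc] [c' lc']; apply: val_inj => /=.
      by move: lc lc'; rewrite n1; clear; lia.
    have N1 : 1 < N by move: bigN; rewrite /index_bound n1.
    have N0 := ltnW N1.
    exists 0, 0, 1, 1; split=> // [Z sZ|Z sZ]; first by exists Z; rewrite // (one (u 0 Z) (u 1 Z)).
    exists (Z :&: P).
      by apply: subset_trans (subsetIr _ _) _; have [] := A_cut N0.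
    split; first exact: one.
    by congr pair; apply/ffunP=> y; rewrite !ffunE; [apply: one | rewrite inE xP andbT].
  apply: (splice_exists (e := e)) => //.
  move: bigN; rewrite /index_bound (negbTE n1) => /ltnW; apply: leq_trans.
  by rewrite card_prod !card_ffun card_prod !card_ord card_bool.
have lN := leq_ltn_trans lj jN; have iN := ltn_trans il lN.
have aN := leq_ltn_trans ai iN.
have [V1 [v1 [p1 [rep1 u1E]]]] := uP j jN.
have [V2 [v2 [p2 [rep2 u2E]]]] := uP i iN.
have cA := A_cut lN.
have sal : A a \subset A l by apply: A_mono; rewrite // (leq_trans ai) // ltnW.
have ej_l (Z : {set T}) : Z \subset A l -> e j \notin Z.
  move=> sZ; apply: contra (e_notin jN); apply: (subsetP (subset_trans sZ (A_mono lj jN))).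
have ei_a (Z : {set T}) : Z \subset A a -> e i \notin Z.
  move=> sZ; apply: contra (e_notin iN); apply: (subsetP (subset_trans sZ (A_mono ai iN))).
have ei_r (W : {set T}) : W \subset ~: A l -> e i \notin W.
  by move=> sW; apply: contraL (e_in il lN) => /(subsetP sW); rewrite inE.
have eB : vrank v1 (~: A l) = vrank v2 (~: A l).
  by have := gr_right rep1 cA; have := gr_right rep2 cA; lia.
have eC : vrank v1 (C :\: A l) = vrank v2 (C :\: A l).
  by rewrite (gr_indep rep1) (gr_indep rep2).
have [V [w [w1 w2 w3]]] := glue (gr_linked rep1) (gr_linked rep2)
  (gr_frame rep1) (gr_frame rep2) (gr_cut rep1 cA) (gr_cut rep2 cA) eC eB.
exists V, w; have [sPl _ _] := cA; have [_ _ lamP] := cP.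
apply: (end_correction hr (vrankP w) sX0 cX0 lamP).
- move=> Q _ /imsetP[h _ ->] vx.
  set x := x_ h in vx *; have xC : x \notin C := xCF (xP h).
  have xl : x \in A l := subsetP sPl _ (xP h).
  pose Z := twist C Q :&: A l; pose W := twist C Q :\: A l.
  have sZ : Z \subset A l := subsetIr _ _.
  have sW : W \subset ~: A l by rewrite /W setDE subsetIr.
  have QE : Q = twist C (Z :|: W).
    by rewrite setID; apply/setP=> z; rewrite !inE; case: (z \in C); case: (z \in Q).
  have [Z' sZ' [eu /pair_eqP/andP[/eqP e1 /eqP e2]]] := beta Z sZ.
  have [Z'' sZ'' [eu' alphaE]] := alpha Z' sZ'.
  have xZ : (x \in Z) = (x \in Q) by rewrite inE xl andbT in_twist.
  have xZ' : (x \in Z') = (x \in Q).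
    by have := congr1 (fun g : {ffun _} => g h) e2; rewrite !ffunE -xZ.
  have st : state v1 S C p1 Z = state v2 S C p2 Z''.
    by apply: kinj; rewrite -u1E -u2E eu' eu.
  have sZ'l := subset_trans sZ' sal; have sZ''l := subset_trans sZ'' sal.
  have := w2 Z Z'' W sZ sZ''l sW st.
  have -> : vrank v2 (twist C Z'') = f Z'' by rewrite (gr_twist rep2) // ei_a.
  have -> : vrank v1 (twist C Z) = f Z by rewrite (gr_twist rep1) // ej_l.
  have -> : vrank v2 (twist C (Z'' :|: W)) = f (Z'' :|: W).
    by rewrite (gr_twist rep2) // inE negb_or ei_a // ei_r.
  have := alphaE W sW.
  have uoE : uo (h, x \in Q) Z = uo (h, x \in Q) Z'.
    by have := congr1 (fun g : {ffun _} => g (h, x \in Q)) e1; rewrite !ffunE.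
  have := uoP (h, x \in Q) vx (A l) Z Z' W cA sZ sZ'l sW xZ xZ' uoE.
  by rewrite -!/(f _) [in r Q]QE -/(f (Z :|: W)) -QE; clear; lia.
- move=> X sX; rewrite w1 ?(gr_end rep1) //; exact: subset_trans sX sPl.
move=> D sD; have sDl : D \subset A l.
  exact: subset_trans (subset_trans sD sX0) sPl.
have -> : ~: D = (A l :\: D) :|: ~: A l by clear -sDl; set_dec.
by apply: leq_trans (w3 _ (subsetDl _ _)) _; apply: (gr_le rep1).
Qed.

End Assembly.

(** * Nested sequences of separations *)

Section NestedSequences.
Variables (I : finType) (F : I -> finFieldType) (q : nat).
Variables (T : finType) (M : matroid T).
Hypothesis Fq : forall i, #|F i| <= q.
Hypothesis ex : excluded_minor (family_representable F (T := T)) M.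
Local Notation r := (total_rank M).

Definition level_bound (m : nat) : nat := index_bound m (q ^ (m * m)).

(** A long chain of cuts of order [m] whose ends are linked represents the
    excluded minor itself: choose an element in every gap, and among the fields
    of the corresponding minors one that occurs often. *)
Lemma no_linked_chain (m G : nat) (A : nat -> {set T}) :
  (forall s, s < G -> A s \proper A s.+1) -> A G \subset ground M ->
  2 * m < #|A 0| ->
  (forall s, s <= G -> r (A s) + r (~: A s) <= r setT + m) ->
  (forall Z : {set T}, A 0 \subset Z -> Z \subset A G ->
     r setT + m <= r Z + r (~: Z)) ->
  #|I| * level_bound m < G -> False.
Proof.
move=> chain sE big0 lam kap bigG.
have hr := total_rankP M.
have Amono s t : s <= t -> t <= G -> A s \subset A t.
  move=> st; elim: t st => [|t IH]; first by rewrite leqn0 => /eqP->.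
  rewrite leq_eqVlt => /orP[/eqP->//|]; rewrite ltnS => st tG.
  by apply: subset_trans (IH st (ltnW tG)) (proper_sub (chain t tG)).
set P := A 0 in big0 kap *; set S := A G in sE kap *.
have sPS : P \subset S by apply: Amono.
have [C lk rC] := linking hr sPS kap.
have cutA s : s <= G -> cut r m P S (A s).
  by move=> sG; split; [apply: Amono | apply: Amono | apply: lam].
have /card_gt0P[x0 x0P] : 0 < #|P| by apply: leq_ltn_trans big0.
pose e s := odflt x0 [pick x in A s.+1 :\: A s].
have eA s : s < G -> e s \in A s.+1 :\: A s.
  move=> /chain /properP[_ [x xA xnA]]; rewrite /e; case: pickP => //= /(_ x).
  by rewrite inE xA xnA.
have C1 x : x \in C -> r [set x] = 1.
  by move=> xC; rewrite (rf_indep_sub hr rC) ?cards1 // sub1set.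
have eSP s : s < G -> e s \in S :\: P.
  move=> sG; have := eA s sG; rewrite !inE => /andP[n1 n2].
  rewrite (subsetP (Amono _ _ sG (leqnn _)) _ n2) andbT.
  by apply: contra n1; apply: (subsetP (Amono 0 s _ (ltnW sG))).
have gap s : s < G -> exists c, represents F c (minor_rank r (e s) (e s \in C)).
  move=> sG; apply: (minor_representation ex); last exact: C1.
  by have := eSP s sG; rewrite inE => /andP[_]; apply: (subsetP sE).
have [c0 _] := gap 0 (leq_ltn_trans (leq0n _) bigG).
have [col colP] := bounded_choice c0 gap.
have [c [idx idxP]] := monochromatic_indices col bigG.
have Fn d : #|F d| ^ (m * m) <= q ^ (m * m).
  by case: m {lam kap big0 bigG lk cutA idxP} => // m; rewrite leq_exp2r.
have n0 : 0 < q ^ (m * m).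
  rewrite expn_gt0; apply/orP; left; apply: leq_trans (Fq c).
  by apply/card_gt0P; exists 0%R.
have idxG s : s < (level_bound m).+1 -> idx s < G by case/idxP.
have idx_lt s t : s < t -> t < (level_bound m).+1 -> idx s < idx t.
  by move=> st /idxP[_ _]; apply.
have [V [v vE]] : represents F c r.
  apply: (assemble hr lk rC (cutA 0 _) (cutA G _) n0 Fn
    (N := (level_bound m).+1) (A := A \o idx) (e := e \o idx)) => //=.
  - by move=> s /idxG sG; apply/cutA/ltnW.
  - move=> s t; rewrite leq_eqVlt => /orP[/eqP->//|st] tN.
    by apply: Amono; apply: ltnW; [apply: idx_lt | apply: idxG].
  - by move=> s /idxG; apply: eSP.
  - by move=> s /idxG/eA; rewrite inE => /andP[].
  - move=> s t st tN; have := eA (idx s) (idxG s (ltn_trans st tN)).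
    rewrite inE => /andP[_]; apply: subsetP; apply: Amono; first exact: idx_lt.
    exact: ltnW (idxG _ tN).
  - by move=> s sN; have [sG <- _] := idxP s sN; apply: colP.
  move=> x b xP vx; apply: (minor_representation ex).
    by apply: (subsetP sE); apply: (subsetP sPS).
  move=> bT; rewrite bT /= in vx; have := rf_card hr [set x].
  have := rf_subadd hr [set x] (~: P); have := rf_mono hr (subsetUr [set x] (~: P)).
  by rewrite cards1; move: vx; lia.
have [notrep _] := ex; apply: notrep; exists c.
exact: representable_of_vrank vE.
Qed.

Definition block_size (m : nat) : nat := #|I| * level_bound m + 2 * m + 3.

(** Induction on the order.  Cut the sequence into blocks.  Either the first and
    last sets of some block are linked, contradicting [no_linked_chain], or every
    block contains a separation of smaller order between its first and last set,
    and these separations are again nested. *)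
Lemma nested_order_bound (m : nat) (A : nat -> {set T}) (L : nat) :
  \prod_(0 <= i < m) block_size i <= L ->
  (forall s t, s < t -> t < L -> A s \proper A t) ->
  (forall s, s < L -> A s \subset ground M) ->
  (forall s, s < L -> r (A s) + r (~: A s) < r setT + m) -> False.
Proof.
have hr := total_rankP M.
elim: m A L => [|m IH] A L.
  rewrite big_nil => L0 _ _ /(_ 0 L0).
  by have := rf_subadd hr (A 0) (~: A 0); rewrite setUCr; lia.
rewrite big_nat_recr //= => bigL chain sE lam.
set Q := \prod_(0 <= i < m) block_size i in bigL IH.
set b := block_size m in bigL.
have b3 : 2 < b by rewrite /b /block_size; lia.
(* Block t consists of the sets with indices from t * b to t * b + b.-1. *)
have inL t s : t < Q -> s < b -> t * b + s < L.
  move=> tQ sb; apply: leq_trans bigL.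
  have : t.+1 * b <= Q * b by rewrite leq_mul2r tQ orbT.
  by lia.
have [/existsP[t /forallP kap]|] := boolP [exists t : 'I_Q, [forall Z : {set T},
    (A (t * b) \subset Z) && (Z \subset A (t * b + b.-1)) ==>
    (r setT + m <= r Z + r (~: Z))]].
  have tQ := ltn_ord t.
  (* The first 2 * m + 1 sets only serve to make the left end large enough. *)
  pose A' s := A (t * b + (2 * m + 1) + s).
  pose G := b.-1 - (2 * m + 1).
  have GE : t * b + (2 * m + 1) + G = t * b + b.-1 by rewrite /G /b /block_size; lia.
  have A'L s : s <= G -> t * b + (2 * m + 1) + s < L.
    move=> sG; rewrite -addnA; apply: inL => //.
    by move: sG; rewrite /G /b /block_size; lia.
  apply: (@no_linked_chain m G A').
  - by move=> s sG; apply: chain; [clear; lia | apply: A'L].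
  - exact/sE/A'L.
  - have cA s : s <= 2 * m + 1 -> s <= #|A (t * b + s)|.
      elim: s => // s IHs sm; apply: leq_ltn_trans (IHs (ltnW sm)) _.
      apply: proper_card; apply: chain; first by clear; lia.
      by apply: inL => //; rewrite /b /block_size; lia.
    by have := cA _ (leqnn _); rewrite /A' addn0; lia.
  - by move=> s /A'L/lam; rewrite -/(A' s); lia.
  - move=> Z s1 s2; have := kap Z; rewrite -GE -/(A' G) s2 andbT.
    have -> : A (t * b) \subset Z.
      apply: subset_trans s1; apply: proper_sub; apply: chain; first by lia.
      exact: A'L.
    by [].
  by rewrite /G /b /block_size; lia.
rewrite negb_exists => /forallP sep.
have {}sep t : t < Q -> exists Z : {set T},
    [/\ A (t * b) \subset Z, Z \subset A (t * b + b.-1) & r Z + r (~: Z) < r setT + m].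
  move=> tQ; have := sep (Ordinal tQ); rewrite negb_forall => /existsP[Z].
  by rewrite negb_imply -ltnNge => /andP[/andP[s1 s2] lt]; exists Z.
have [Z ZP] := bounded_choice set0 sep.
apply: (IH Z Q) => //.
- move=> s t st tQ; have [_ s2 _] := ZP s (ltn_trans st tQ).
  have [s1 _ _] := ZP t tQ; apply: sub_proper_trans s2 _.
  apply: proper_sub_trans s1; apply: chain.
    have : s.+1 * b <= t * b by rewrite leq_mul2r st orbT.
    by move: b3; lia.
  by have := inL t 0 tQ; rewrite addn0; apply; lia.
- move=> s sQ; have [_ s2 _] := ZP s sQ; apply: subset_trans s2 _.
  by apply: sE; apply: inL => //; lia.
by move=> s sQ; have [] := ZP s sQ.
Qed.

End NestedSequences.

(** * Size estimates *)

Lemma core_base_le (q n : nat) : 1 < q -> 0 < n -> core_base n <= q ^ (n * n).+1.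
Proof.
move=> q1 n0; have nn : 0 < n * n by rewrite muln_gt0 n0.
have : q <= q ^ (n * n) by have := leq_pexp2l (ltnW q1) nn; rewrite expn1.
have : 2 ^ (n * n) <= q ^ (n * n) by rewrite leq_exp2r.
rewrite /core_base expnS; have : 2 * q ^ (n * n) <= q * q ^ (n * n) by rewrite leq_mul2r q1 orbT.
by lia.
Qed.

Lemma succ_pow_le (q x : nat) : 1 < q -> (q ^ x).+1 <= q ^ x.+1.
Proof.
move=> q1; have : 0 < q ^ x by rewrite expn_gt0; lia.
rewrite expnS; have : 2 * q ^ x <= q * q ^ x by rewrite leq_mul2r q1 orbT.
by lia.
Qed.

Lemma level_bound_le (q m : nat) : 1 < q ->
  level_bound q m <= q ^ (q ^ (4 * (m * m * m) + 5 * (m * m) + 2 * m + 3)).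
Proof.
move=> q1; have q0 := ltnW q1; rewrite /level_bound /index_bound; case: eqP => [_|_].
  by rewrite expn_gt0 q0.
set n := q ^ (m * m); have n0 : 0 < n by rewrite expn_gt0 q0.
apply: (@leq_trans ((q ^ (n * n).+1) ^ (n * outer_size m n).+1)).
  by rewrite leq_exp2r // core_base_le.
rewrite -expnM leq_exp2l //.
have h1 : (n * n).+1 <= q ^ (m * m + m * m).+1 by rewrite /n -expnD succ_pow_le.
have h2 : n * outer_size m n <= q ^ (m * m + (m * m * ((2 * m).+1 * 2) + (2 * m).+1)).
  rewrite /outer_size /n -expnM !expnD !leq_mul2l leq_exp2r // q1 !orbT //.
have h3 : (n * outer_size m n).+1 <=
    q ^ (m * m + (m * m * ((2 * m).+1 * 2) + (2 * m).+1)).+1.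
  by apply: leq_trans (succ_pow_le _ q1).
apply: leq_trans (leq_mul h1 h3) _; rewrite -expnD leq_exp2l //.
by nia.
Qed.

Lemma double_pow_add (q x y : nat) : 1 < q ->
  q ^ (q ^ x) + q ^ (q ^ y) <= q ^ (q ^ (x + y).+1).
Proof.
move=> q1; have q0 := ltnW q1.
have p z : 1 < q ^ (q ^ z).
  by rewrite -[1](expn0 q) ltn_exp2l // expn_gt0 q0.
apply: (@leq_trans (q ^ (q ^ x) * q ^ (q ^ y))).
  by have := p x; have := p y; nia.
rewrite -expnD leq_exp2l // expnS expnD.
have h z : 0 < q ^ z by rewrite expn_gt0 q0.
have : 2 * (q ^ x * q ^ y) <= q * (q ^ x * q ^ y) by rewrite leq_mul2r q1 orbT.
move: (q ^ x) (q ^ y) (h x) (h y) => a b a0 b0; apply: leq_trans; nia.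
Qed.

Lemma block_prod_bound (c q k : nat) : 0 < c -> 1 < q ->
  \prod_(0 <= m < k) (c * level_bound q m + 2 * m + 3) <=
  c ^ k.+1 * tower [:: q; q; k; 6].
Proof.
move=> c0 q1; rewrite /tower /= expn1; have q0 := ltnW q1.
case: k => [|[|k]].
- by rewrite big_nil muln_gt0 !expn_gt0; lia.
- rewrite big_nat1 /level_bound /index_bound /= exp1n expn1.
  have : 4 <= q ^ q.
    by apply: (@leq_trans (2 ^ q)); [rewrite -[4]/(2 ^ 2) leq_exp2l | rewrite leq_exp2r; lia].
  by rewrite expnS expn1 muln1; nia.
set K := k.+2; pose j := k.+1.
pose E := (4 * (j * j * j) + 5 * (j * j) + 2 * j + 3 + (2 * K + 3)).+1.
have factor m : m < K -> c * level_bound q m + 2 * m + 3 <= c * q ^ (q ^ E).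
  move=> mK; have mj : m <= j by [].
  have pos : 0 < q ^ (q ^ E) by rewrite expn_gt0 q0.
  apply: (@leq_trans (c * (level_bound q m + (2 * K + 3)))); first by rewrite mulnDr; nia.
  rewrite leq_mul2l; apply/orP; right; apply: leq_trans (double_pow_add _ _ q1).
  apply: leq_add.
    apply: leq_trans (level_bound_le _ q1) _; rewrite !leq_exp2l //.
    have : m * m <= j * j by rewrite leq_mul.
    have : m * m * m <= j * j * j by rewrite !leq_mul.
    by lia.
  apply: (@leq_trans (q ^ (2 * K + 3))); first by apply/ltnW/ltn_expl.
  by rewrite leq_exp2l //; apply/ltnW/ltn_expl.
apply: (@leq_trans (\prod_(0 <= m < K) (c * q ^ (q ^ E)))).
  rewrite big_nat_cond [X in _ <= X]big_nat_cond.
  by apply: leq_prod => m /andP[/andP[_ mK] _]; apply: factor.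
rewrite prod_nat_const_nat subn0 expnMn; apply: leq_mul.
  by rewrite leq_pexp2l.
rewrite -expnM leq_exp2l //; apply: (@leq_trans (q ^ E * q ^ K)).
  by rewrite leq_mul2l; apply/orP; right; apply/ltnW/ltn_expl.
rewrite -expnD leq_exp2l //.
have -> : K ^ 6 = (K * K * K) * (K * K * K) by rewrite !expnS expn0 muln1 !mulnA.
have K3 : 8 <= K * K * K by rewrite -[8]/(2 * 2 * 2) !leq_mul.
apply: (@leq_trans (8 * (K * K * K))); last by rewrite leq_mul2r K3 orbT.
by rewrite /E /K -/j -[k.+2]/(j.+1); have : 0 < j by []; nia.
Qed.

Unset Implicit Arguments.

(* The finite set of fields is the range of the injective family F. *)
Theorem theorem5p3 (I : finType) (F : I -> finFieldType) (q k : nat)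
    (T : finType) (M : matroid T) :
  0 < #|I| ->
  injective F ->
  (forall i : I, #|F i| <= q) ->
  excluded_minor (family_representable F (T := T)) M ->
  ~ exists s : seq ({set T} * {set T}),
      size s = #|I| ^ k.+1 * tower [:: q; q; k; 6] /\ nested_separations M k s.
Proof.
move=> I0 _ Fq ex [s [sz /andP[/allP sep so]]].
have /card_gt0P[i _] := I0.
have q1 : 1 < q := leq_trans (card_finNzRing_gt1 (F i)) (Fq i).
pose A t := (nth (set0, set0) s t).1.
have sepA t : t < size s -> separation M k (nth (set0, set0) s t).
  by move=> lt; apply/sep/mem_nth.
have AE t : t < size s -> A t \subset ground M.
  by move=> /sepA/and5P[/eqP <- _ _ _ _]; apply: subsetUl.
apply: (@nested_order_bound I F q T M Fq ex k A (size s)) => //.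
- by rewrite sz; apply: block_prod_bound.
- move=> t u tu us; apply: (sorted_ltn_nth _ (set0, set0) so) => //.
    by move=> x y z; apply: proper_trans.
  by rewrite inE (ltn_trans tu).
move=> t lt; have /and5P[_ _ _ _] := sepA t lt; rewrite -/(A t) /connectivity.
rewrite /total_rank (setIidPl (AE t lt)) setTI setIC -setDE => con.
by lia.
Qed.
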